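(* Let $(P,Q)$ be a pair of orthogonal projections on a Hilbert space $\mathcal{H}$, with operator matrices $$P=I_1\oplus I_2\oplus 0I_3\oplus 0I_4\oplus I_5\oplus 0I_6,$$ $$Q=I_1\oplus 0I_2\oplus I_3\oplus 0I_4\oplus\begin{pmatrix} Q_0 & Q_0^{1/2}(I_5-Q_0)^{1/2}D\\ D^*Q_0^{1/2}(I_5-Q_0)^{1/2} & D^*(I_5-Q_0)D\end{pmatrix}$$ with respect to the decomposition $\mathcal{H}=\bigoplus_{i=1}^6\mathcal{H}_i$ described in the context. There exists a unitary $U\in\mathcal{U}(\mathcal{H})$ such that $PU=UQ$ and $UP=QU$ if and only if $$\dim\big(\mathcal{R}(P)\cap\mathcal{N}(Q)\big)=\dim\big(\mathcal{N}(P)\cap\mathcal{R}(Q)\big).$$ Moreover, if $\dim(\mathcal{R}(P)\cap\mathcal{N}(Q))=\dim(\mathcal{N}(P)\cap\mathcal{R}(Q))$, then $\mathrm{int}\,\mathcal{U}_Q(P)$ is exactly the set of all operators of the form $$U_1\oplus\begin{pmatrix}0&C_2\\C_3&0\end{pmatrix}\oplus U_4\oplus\begin{pmatrix}Q_0^{1/2} & (I_5-Q_0)^{1/2}D\\ D^*(I_5-Q_0)^{1/2} & -D^*Q_0^{1/2}D\end{pmatrix}\begin{pmatrix}U_0&0\\0&D^*U_0D\end{pmatrix}$$ with respect to $\mathcal{H}=\mathcal{H}_1\oplus(\mathcal{H}_2\oplus\mathcal{H}_3)\oplus\mathcal{H}_4\oplus(\mathcal{H}_5\oplus\mathcal{H}_6)$,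 where $U_1\in\mathcal{U}(\mathcal{H}_1)$, $C_2\in\mathcal{U}(\mathcal{H}_3,\mathcal{H}_2)$, $C_3\in\mathcal{U}(\mathcal{H}_2,\mathcal{H}_3)$, $U_4\in\mathcal{U}(\mathcal{H}_4)$, and $U_0\in\mathcal{U}(\mathcal{H}_5)$ with $U_0Q_0=Q_0U_0$.
   Context: For Hilbert spaces $\mathcal{K},\mathcal{L}$, $\mathcal{U}(\mathcal{K})$ is the set of unitary operators on $\mathcal{K}$ and $\mathcal{U}(\mathcal{K},\mathcal{L})$ is the set of unitary operators from $\mathcal{K}$ onto $\mathcal{L}$; $\mathcal{R}(A)$ and $\mathcal{N}(A)$ denote the range and null space of $A$; $\dim$ is Hilbert space dimension. An orthogonal projection is a bounded operator $P$ with $P=P^*=P^2$. The set of intertwining operators of $(P,Q)$ is $\mathrm{int}\,\mathcal{U}_Q(P)=\{U\in\mathcal{U}(\mathcal{H}): UP=QU\text{ and }PU=UQ\}$. Decomposition: $\mathcal{H}_1=\mathcal{R}(P)\cap\mathcal{R}(Q)$, $\mathcal{H}_2=\mathcal{R}(P)\cap\mathcal{N}(Q)$, $\mathcal{H}_3=\mathcal{N}(P)\cap\mathcal{R}(Q)$, $\mathcal{H}_4=\mathcal{N}(P)\cap\mathcal{N}(Q)$, $\mathcal{H}_5=\mathcal{R}(P)\ominus(\mathcal{H}_1\oplus\mathcal{H}_2)$, $\mathcal{H}_6=\mathcal{H}\ominus\bigoplus_{j=1}^5\mathcal{H}_j$ (some of these may be $\{0\}$). $I_i$ is the identity on $\mathcal{H}_i$;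 $Q_0$ is a positive contraction on $\mathcal{H}_5$ for which neither $0$ nor $1$ is an eigenvalue; $D$ is a unitary from $\mathcal{H}_6$ onto $\mathcal{H}_5$. It is a known fact that every pair of orthogonal projections admits operator matrices of this form. *)

(* Defs.v *)
From HB Require Import structures.
From mathcomp Require Export all_boot all_order all_algebra.
From mathcomp Require Export complex.
From mathcomp Require Export all_classical all_reals all_analysis.
Export Order.TTheory GRing.Theory Num.Theory.
Export numFieldNormedType.Exports.

Set Implicit Arguments.
Unset Strict Implicit.
Unset Printing Implicit Defensive.

Local Open Scope classical_set_scope.
Local Open Scope ring_scope.

(* A complex Hilbert space is a complete normed R[i]-module H together with an
   inner product [dot], linear in its first argument, inducing the norm of H:
   dot x x = `|x| ^+ 2.

   An operator from a subspace M of H to a subspace N of H is given by a map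
   H -> H of which only the restriction to M matters: all the predicates below
   taking M (and N) as arguments look at the values on M only. *)

Section HilbertSpace.
Variables (R : realType) (H : completeNormedModType R[i]).
Variable dot : {dot H for @Num.conj R[i]}.
Implicit Types (M N B C : set H) (f g A S P Q U : H -> H).

Definition nullspace A : set H := [set x | A x = 0].

Definition hsum M N : set H := [set x + y | x in M & y in N].

Definition ominus M N : set H :=
  [set x | M x /\ forall y, N y -> dot x y = 0].

Definition bounded_op M N f : Prop :=
  [/\ forall x, M x -> N (f x),
      forall (a : R[i]) x y, M x -> M y -> f (a *: x + y) = a *: f x + f y
    & exists k : R[i], forall x, M x -> `|f x| <= k * `|x|].

Definition adjoint_op M N f g : Prop :=
  [/\ bounded_op M N f, bounded_op N M g
    & forall x y, M x -> N y -> dot (f x) y = dot x (g y)].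

Definition unitary_op M N f : Prop :=
  exists g, [/\ adjoint_op M N f g,
                forall x, M x -> g (f x) = x
              & forall y, N y -> f (g y) = y].

Definition orthogonal_projection P : Prop :=
  adjoint_op setT setT P P /\ P \o P = P.

(* In the order of R[i], 0 <= z means that z is real and nonnegative. *)
Definition positive_op M f : Prop :=
  bounded_op M M f /\ forall x, M x -> 0 <= dot (f x) x.

Definition contraction M f : Prop := forall x, M x -> `|f x| <= `|x|.

Definition is_eigenvalue M f (a : R[i]) : Prop :=
  exists x, [/\ M x, x != 0 & f x = a *: x].

(* S is the positive square root of A, i.e. S = A^{1/2}, on M *)
Definition is_psqrt M A S : Prop :=
  positive_op M S /\ forall x, M x -> S (S x) = A x.

Definition orthonormal_set B : Prop :=
  forall x y, B x -> B y -> dot x y = (x == y)%:R.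

Definition hilbert_basis M B : Prop :=
  [/\ orthonormal_set B, B `<=` M
    & forall C, orthonormal_set C -> C `<=` M -> B `<=` C -> C = B].

(* The Hilbert space dimension of a closed subspace is the common cardinality
   of all its orthonormal bases. *)
Definition same_dim M N : Prop :=
  exists B C, [/\ hilbert_basis M B, hilbert_basis N C & (B #= C)%card].

Definition intertwining P Q : set (H -> H) :=
  [set U | [/\ unitary_op setT setT U, U \o P = Q \o U & P \o U = U \o Q]].

Section Decomposition.
Variables P Q : H -> H.

Definition H1 : set H := range P `&` range Q.
Definition H2 : set H := range P `&` nullspace Q.
Definition H3 : set H := nullspace P `&` range Q.
Definition H4 : set H := nullspace P `&` nullspace Q.
Definition H5 : set H := ominus (range P) (hsum H1 H2).
Definition H6 : set H :=
  ominus setT (hsum (hsum (hsum (hsum H1 H2) H3) H4) H5).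

(* A maps x1 + ... + x6, with each xi in Hi, to E x1 ... x6; this is how
   operator matrices with respect to H = H1 (+) ... (+) H6 are written. *)
Definition acts_as A (E : H -> H -> H -> H -> H -> H -> H) : Prop :=
  forall x1 x2 x3 x4 x5 x6,
    H1 x1 -> H2 x2 -> H3 x3 -> H4 x4 -> H5 x5 -> H6 x6 ->
    A (x1 + x2 + x3 + x4 + x5 + x6) = E x1 x2 x3 x4 x5 x6.

End Decomposition.

(* 2 x 2 operator matrix ( A11 A12 ; A21 A22 ), acting on pairs of components *)
Definition block2 (A11 A12 A21 A22 : H -> H) (x : H * H) : H * H :=
  (A11 x.1 + A12 x.2, A21 x.1 + A22 x.2).

(* The vector of M (+) N with the given pair of components *)
Definition join2 (x : H * H) : H := x.1 + x.2.

End HilbertSpace.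

(* Main.v *)
Require Import Defs.
From mathcomp Require Import ring lra.

Set Implicit Arguments.
Unset Strict Implicit.
Unset Printing Implicit Defensive.

Local Open Scope classical_set_scope.
Local Open Scope ring_scope.
Local Open Scope complex_scope.

(** An intertwining unitary U turns the behaviour of P at x into that of Q at
U x, and vice versa, so it maps H1 and H4 onto themselves and swaps H2 with H3;
hence dim H2 = dim H3 ([intertwining_same_dim]).  Conversely, equal dimensions
give a unitary from H2 onto H3 ([same_dim_unitary]), and on H5 + H6 the pair is
intertwined by the matrix (S, T D; D* T, - D* S D).  Identifying H6 with H5
through D, this is (S, T; T, -S), a self-adjoint involution because
S^2 + T^2 = 1 and S T = T S; its first column e |-> (S e, T e) is an isometry
from H5, the range of P, onto the range of Q.  So every operator of the
announced form is a unitary intertwiner ([form_intertwining]), which settles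
existence.

For the classification, let W be one intertwiner of the announced form, with
identities in the free diagonal slots.  If U is any other, V = W^-1 U is a
unitary commuting with both P and Q.  It therefore preserves H5 and H6, its
restriction to H5 commutes with Q0, and the off-diagonal entries of Q force its
restriction to H6 to be D* V D ([commutant_blocks]).  Writing U = W V on H5 + H6
gives the announced form ([intertwining_has_form]).

Both directions use that an operator commuting with Q0 commutes with the square
roots S and T.  This is proved without functional calculus.  Let T be an
injective positive contraction, X commute with T^2, and Y = X T - T X.  Then
Y T = - T Y, so Y (1 - T)^n = (1 + T)^n Y.  As 1 - T is a contraction, the
left side stays bounded along n, while |(1 + T)^n y|^2 >= 2 n <T y, y>.  Hence
<T Y x, Y x> = 0, so T Y x = 0 and Y = 0 ([commute_of_commute_sqr]).

The unitary between spaces of equal dimension is obtained as a graph: a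
bijection between orthonormal bases is a set of pairs, and the closed linear
relation that it generates preserves inner products, so it is single valued
with a closed domain.  The projection theorem ([projection]) and the maximality
of the basis show that the domain is the whole space; applied to the converse
relation, the same argument gives surjectivity. *)

(** * Inner product geometry *)

Section Geometry.
Variables (R : realType) (H : completeNormedModType R[i]).
Variable dot : {dot H for @Num.conj R[i]}.
Hypothesis dot_norm : forall x : H, dot x x = `|x| ^+ 2.
Implicit Types (x y z : H) (M N : set H) (a : R[i]).

Lemma dotC x y : dot x y = (dot y x)^*%R.
Proof. by rewrite (@hermC _ _ _ _ dot) expr0 mul1r. Qed.

Lemma dotDl x y z : dot (x + y) z = dot x z + dot y z.
Proof. exact: linearDl. Qed.
Lemma dotDr x y z : dot z (x + y) = dot z x + dot z y.
Proof. exact: linearDr. Qed.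
Lemma dotNl x z : dot (- x) z = - dot x z.
Proof. exact: linearNl. Qed.
Lemma dotNr x z : dot z (- x) = - dot z x.
Proof. exact: linearNr. Qed.
Lemma dotZl a x z : dot (a *: x) z = a * dot x z.
Proof. exact: linearZl_LR. Qed.
Lemma dotZr a x z : dot z (a *: x) = a^*%R * dot z x.
Proof. exact: linearZr_LR. Qed.
Lemma dot0l z : dot 0 z = 0. Proof. exact: linear0l. Qed.
Lemma dot0r z : dot z 0 = 0. Proof. exact: linear0r. Qed.
Definition dotE := (dotDl, dotDr, dotNl, dotNr, dotZl, dotZr, dot0l, dot0r).

Lemma dot_eq0 x : dot x x = 0 -> x = 0.
Proof. by move/eqP; rewrite dnorm_eq0 => /eqP. Qed.

Lemma dot_sym0 x y : dot x y = 0 -> dot y x = 0.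
Proof. by rewrite (dotC y) => ->; rewrite rmorph0. Qed.

(** Norms and inner products live in R[i], which is only partially ordered;
[nr] and [dr] are their real-valued counterparts, on which infima, archimedean
arguments and linear arithmetic are available. *)
Definition nr x : R := complex.Re `|x|.
Definition dr x y : R := complex.Re (dot x y).

Lemma nrE x : `|x| = (nr x)%:C.
Proof. by rewrite /nr RRe_real // normr_real. Qed.

Lemma nr_ge0 x : 0 <= nr x.
Proof. by rewrite -ler0c -nrE. Qed.

Lemma nrN x : nr (- x) = nr x.
Proof. by rewrite /nr normrN. Qed.

Lemma nr_dist x y z : nr (x - y) <= nr (z - x) + nr (z - y).
Proof.
rewrite -lecR rmorphD /= -!nrE.
by have := ler_distD z x y; rewrite (distrC x z).
Qed.

Lemma nr_sqr x : nr x ^+ 2 = dr x x.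
Proof. by rewrite /dr dot_norm nrE -rmorphXn. Qed.

Lemma dot_dr x : dot x x = (dr x x)%:C.
Proof. by rewrite -nr_sqr dot_norm nrE rmorphXn. Qed.

Lemma drC x y : dr x y = dr y x.
Proof. by rewrite /dr dotC; case: (dot y x). Qed.
Lemma drDl x y z : dr (x + y) z = dr x z + dr y z.
Proof. by rewrite /dr dotDl raddfD. Qed.
Lemma drDr x y z : dr z (x + y) = dr z x + dr z y.
Proof. by rewrite /dr dotDr raddfD. Qed.
Lemma drNl x z : dr (- x) z = - dr x z.
Proof. by rewrite /dr dotNl raddfN. Qed.
Lemma drNr x z : dr z (- x) = - dr z x.
Proof. by rewrite /dr dotNr raddfN. Qed.
Lemma drZl (t : R) x z : dr (t%:C *: x) z = t * dr x z.
Proof. by rewrite /dr dotZl; case: (dot x z) => u v /=; rewrite mul0r subr0. Qed.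
Lemma drZr (t : R) x z : dr z (t%:C *: x) = t * dr z x.
Proof. by rewrite drC drZl drC. Qed.
Definition drE := (drDl, drDr, drNl, drNr, drZl, drZr).

Lemma dr_ge0 x : 0 <= dr x x.
Proof. by rewrite -nr_sqr sqr_ge0. Qed.

Lemma dr_eq0 x : dr x x = 0 -> x = 0.
Proof. by move=> h; apply: dot_eq0; rewrite dot_dr h. Qed.

(** Positivity of |x - t y|^2 at the t for which x - t y is orthogonal to y. *)
Lemma cauchy_schwarz x y : `|dot x y| <= `|x| * `|y|.
Proof.
have [->|y0] := eqVneq y 0; first by rewrite dot0r !normr0 mulr0.
have n0 : `|y| != 0 by rewrite normr_eq0.
pose t := dot x y / `|y| ^+ 2.
have := dnorm_ge0 dot (x - t *: y).
rewrite !dotE !dot_norm (dotC y x).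
have -> : t^*%R = (dot x y)^*%R / `|y| ^+ 2.
  by rewrite /t rmorphM fmorphV rmorphXn /= (conj_Creal (normr_real y)).
set d := dot x y.
have -> : `|x| ^+ 2 + - (d^*%R / `|y| ^+ 2 * d)
   + (- (t * d^*%R) - - (t * (d^*%R / `|y| ^+ 2 * `|y| ^+ 2)))
  = `|x| ^+ 2 - (d * d^*%R) / `|y| ^+ 2 by field.
rewrite -normCK subr_ge0 ler_pdivrMr ?exprn_gt0 ?normr_gt0 // -exprMn.
by rewrite ler_pXn2r // nnegrE ?mulr_ge0.
Qed.

Lemma dr_le x y : `|dr x y| <= nr x * nr y.
Proof.
rewrite -lecR rmorphM /= -!nrE; apply: le_trans (cauchy_schwarz x y).
exact: normc_ge_Re.
Qed.

Lemma cvg_dotl (u : nat -> H) x y :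
  u @ \oo --> x -> (fun n => dot (u n) y) @ \oo --> dot x y.
Proof.
move=> ux; apply/cvgrPdist_lt => e e0.
have k0 : 0 < `|y| + 1 by rewrite ltr_wpDl.
have /cvgrPdist_lt /(_ _ (divr_gt0 e0 k0)) := ux.
apply: filterS => n; rewrite ltr_pdivlMr // => h.
rewrite -dotNl -dotDl; apply: le_lt_trans (cauchy_schwarz _ _) _.
by apply: le_lt_trans h; rewrite ler_wpM2l // lerDl.
Qed.

Lemma nr_cvg (u : nat -> H) x : u @ \oo --> x ->
  forall e : R, 0 < e -> \forall n \near \oo, nr (x - u n) < e.
Proof.
move=> ux e e0; have /cvgrPdist_lt /(_ e%:C) := ux.
rewrite ltcR => /(_ e0); apply: filterS => n.
by rewrite nrE ltcR.
Qed.

Lemma cauchy_nr_cvg (u : nat -> H) :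
  (forall e : R, 0 < e ->
     exists k, forall m n, (k <= m)%N -> (k <= n)%N -> nr (u m - u n) < e) ->
  exists x, u @ \oo --> x.
Proof.
move=> h; have : cvg (u @ \oo).
  apply: cauchy_cvg; apply: cauchy_exP => e e0.
  have e1 : (complex.Re e)%:C = e by rewrite RRe_real // gtr0_real.
  have : 0 < complex.Re e by rewrite -ltcR e1.
  move=> /h [N hN]; exists (u N), N => // n /= Nn.
  by rewrite /= -ball_normE /ball_ /= nrE -e1 ltcR hN.
by move=> /cvg_ex.
Qed.

(** * Closed subspaces and the projection theorem *)

Definition subspace M := M 0 /\ forall a x y, M x -> M y -> M (a *: x + y).
Definition seq_closed M :=
  forall (u : nat -> H) x, (forall n, M (u n)) -> u @ \oo --> x -> M x.

Definition closed_subspace M := subspace M /\ seq_closed M.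

Section Subspace.
Variable M : set H.
Hypothesis sM : subspace M.
Lemma subspace0 : M 0. Proof. exact: sM.1. Qed.
Lemma subspaceD x y : M x -> M y -> M (x + y).
Proof. by move=> hx hy; rewrite -(scale1r x); apply: sM.2. Qed.
Lemma subspaceZ a x : M x -> M (a *: x).
Proof.
by move=> hx; rewrite -(addr0 (a *: x)); apply: sM.2 => //; exact: subspace0.
Qed.
Lemma subspaceN x : M x -> M (- x).
Proof. by move=> hx; rewrite -scaleN1r; apply: subspaceZ. Qed.
Lemma subspaceB x y : M x -> M y -> M (x - y).
Proof. by move=> hx hy; apply: subspaceD => //; apply: subspaceN. Qed.
End Subspace.

(** H1, ..., H6 are all intersections of orthogonal complements, which is how
their closedness is obtained. *)
Definition ortho (A : set H) : set H := [set x | forall y, A y -> dot x y = 0].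

Lemma ortho_subspace A : subspace (ortho A).
Proof.
split=> [y _|a x y hx hy z Az]; first by rewrite dot0l.
by rewrite !dotE hx // hy // mulr0 addr0.
Qed.

Lemma ortho_closed A : seq_closed (ortho A).
Proof.
move=> u x hu ux y Ay; have := cvg_dotl (y := y) ux.
have -> : (fun n => dot (u n) y) = fun=> 0 by apply/funext => n; exact: hu.
move=> h; apply: (cvg_unique (@norm_hausdorff _ _) h); exact: cvg_cst.
Qed.

Lemma dr_subZ (t : R) x y : dr (x - t%:C *: y) (x - t%:C *: y) =
  dr x x - 2 * t * dr x y + t * (t * dr y y).
Proof. by rewrite !drE (drC y x); ring. Qed.

Lemma inf_near_min M x : subspace M -> exists d : R,
  (forall m, M m -> d <= dr (x - m) (x - m)) /\
  forall e, 0 < e -> exists2 m, M m & dr (x - m) (x - m) < d + e.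
Proof.
move=> sM; pose E := [set dr (x - m) (x - m) | m in M].
have hE : has_inf E.
  split; first by exists (dr (x - 0) (x - 0)), 0 => //; exact: subspace0.
  by exists 0 => _ [m _ <-]; exact: dr_ge0.
exists (inf E); split=> [m Mm|e e0].
  by apply: ge_inf; [case: hE|exists m].
by have [_ [m Mm <-] lt] := inf_adherent e0 hE; exists m.
Qed.

(** If m is within e^2 of minimizing the squared distance d to x, moving m along
y cannot gain more than e^2; at the best step t = <x - m, y> / |y|^2 the gain is
<x - m, y>^2 / |y|^2. *)
Lemma near_min_orth M x (d e : R) m y : subspace M ->
  (forall m, M m -> d <= dr (x - m) (x - m)) ->
  M m -> dr (x - m) (x - m) < d + e ^+ 2 -> 0 < e -> M y ->
  `|dr (x - m) y| <= e * nr y.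
Proof.
move=> sM hd Mm hm e0 My.
have [->|y0] := eqVneq y 0.
  by rewrite /dr dot0r /= normr0 mulr_ge0 ?nr_ge0 // ltW.
have Y0 : 0 < dr y y.
  rewrite lt_neqAle dr_ge0 andbT eq_sym; apply: contra y0 => /eqP h.
  exact/eqP/dr_eq0.
set s := dr (x - m) y.
have sq : s ^+ 2 <= e ^+ 2 * dr y y.
  pose t := s / dr y y.
  have := hd (m + t%:C *: y) (subspaceD sM Mm (subspaceZ sM _ My)).
  have -> : x - (m + t%:C *: y) = (x - m) - t%:C *: y by rewrite opprD addrA.
  rewrite dr_subZ -/s => h.
  have : t * dr y y = s by rewrite /t divfK // gt_eqF.
  move=> tE; have : t * s <= e ^+ 2.
    by move: h hm; rewrite tE; lra.
  by rewrite /t mulrAC -expr2 ler_pdivrMr.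
have p0 : 0 <= e * nr y by rewrite mulr_ge0 ?nr_ge0 // ltW.
rewrite -(ler_pXn2r (n := 2)) ?nnegrE // -normrX ger0_norm ?sqr_ge0 //.
by rewrite exprMn nr_sqr.
Qed.

Lemma parallelogram x m m' :
  dr (m - m') (m - m') = 2 * dr (x - m) (x - m) + 2 * dr (x - m') (x - m')
    - 4 * dr (x - (2^-1)%:C *: (m + m')) (x - (2^-1)%:C *: (m + m')).
Proof.
by rewrite !drE (drC m x) (drC m' x) (drC m' m); lra.
Qed.

(** A minimizing sequence for the distance from x to M is Cauchy by the
parallelogram identity, because the midpoint of two of its terms is again in M;
its limit m is the foot of the perpendicular. *)
Lemma projection M x : subspace M -> seq_closed M ->
  exists2 m, M m & ortho M (x - m).
Proof.
move=> sM cM; have [d [hd hm]] := inf_near_min x sM.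
have /choice [u hu] : forall n : nat, exists m,
    M m /\ dr (x - m) (x - m) < d + (n.+1%:R^-1) ^+ 2.
  by move=> n; have [|m ? ?] := hm ((n.+1%:R^-1) ^+ 2);
    [rewrite exprn_gt0 // invr_gt0|exists m].
have small (e : R) : 0 < e -> exists k, forall n, (k <= n)%N -> n.+1%:R^-1 < e.
  move=> e0; exists (Num.truncn e^-1) => n Nn.
  rewrite -ltf_pV2 ?posrE ?invr_gt0 // invrK.
  by apply: (lt_le_trans (truncnS_gt _)); rewrite ler_nat ltnS.
have [m um] : exists m : H, u @ \oo --> m.
  apply: cauchy_nr_cvg => e e0.
  have [|N hN] := small (e / 2); first by rewrite divr_gt0.
  exists N => i j /hN hi /hN hj.
  rewrite -(ltr_pXn2r (n := 2)) ?nnegrE ?nr_ge0 ?ltW // nr_sqr (parallelogram x).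
  have := hd _ (subspaceZ sM (2^-1)%:C (subspaceD sM (hu i).1 (hu j).1)).
  have := (hu i).2; have := (hu j).2.
  have p k : 0 <= (k.+1%:R : R)^-1 by rewrite invr_ge0.
  have := p i; have := p j.
  by move: (i.+1%:R^-1) (j.+1%:R^-1) hi hj => ? ? ? ? ? ? ? ?; nra.
have Mm : M m by apply: cM um => n; case: (hu n).
exists m => //.
(* The limit inherits orthogonality from the terms of the sequence. *)
have h y : M y -> dr (x - m) y = 0.
  move=> My; apply/eqP; rewrite -normr_eq0; apply/eqP/le_anti.
  rewrite normr_ge0 andbT; apply/ler_addgt0Pl => e e0; rewrite addr0.
  have k0 : 0 < 2 * (nr y + 1) by rewrite mulr_gt0 // ltr_wpDl ?nr_ge0.
  pose f := e / (2 * (nr y + 1)).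
  have f0 : 0 < f by rewrite divr_gt0.
  have [N hN] := small _ f0.
  have [N' _ hN'] := nr_cvg um f0.
  pose n := maxn N N'.
  have a1 : `|dr (x - u n) y| <= f * nr y.
    apply: (near_min_orth sM hd (hu n).1 _ f0 My).
    apply: lt_le_trans (hu n).2 _; rewrite lerD2l ler_pXn2r ?nnegrE ?ltW //.
    by apply: hN; exact: leq_maxl.
  have a2 : nr (m - u n) < f by apply: hN'; rewrite /= leq_maxr.
  have a3 : `|dr (m - u n) y| <= f * nr y.
    apply: le_trans (dr_le _ _) _; apply: ler_wpM2r; rewrite ?nr_ge0 //.
    exact: ltW.
  have -> : x - m = (x - u n) - (m - u n) by rewrite opprB addrA addrNK.
  rewrite drDl drNl; apply: le_trans (ler_normB _ _) _.
  have : e = f * (2 * (nr y + 1)) by rewrite /f divfK // gt_eqF.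
  move: (`|dr _ y|) (`|dr _ y|) a1 a3 => ? ? ? ?.
  by move=> ->; lra.
(* Real orthogonality to both y and iy is complex orthogonality to y. *)
move=> y My; have := h y My; have := h ('i%C *: y) (subspaceZ sM _ My).
rewrite /dr dotZr; case: (dot _ _) => p q /=.
move=> h1 ->; have -> : q = 0 by lra.
by [].
Qed.
End Geometry.

(** * Bounded and unitary operators between subspaces *)

Section LinearMaps.
Variables (R : realType) (H : completeNormedModType R[i]).
Variable dot : {dot H for @Num.conj R[i]}.
Implicit Types (x y z : H) (M N : set H) (a : R[i]) (f g : H -> H).

Section BoundedOperator.
Variables (M N : set H) (f : H -> H).
Hypotheses (sM : subspace M) (bf : bounded_op M N f).
Lemma bounded_op_in x : M x -> N (f x). Proof. by case: bf => h _ _; exact: h. Qed.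
Lemma bounded_opP a x y : M x -> M y -> f (a *: x + y) = a *: f x + f y.
Proof. by case: bf => _ h _; exact: h. Qed.
Lemma bounded_op0 : f 0 = 0.
Proof.
have := bounded_opP 1 (subspace0 sM) (subspace0 sM); rewrite !scale1r addr0 => /eqP.
by rewrite -subr_eq subrr => /eqP.
Qed.
Lemma bounded_opD x y : M x -> M y -> f (x + y) = f x + f y.
Proof. by move=> Mx My; rewrite -{1}(scale1r x) bounded_opP // scale1r. Qed.
Lemma bounded_opZ a x : M x -> f (a *: x) = a *: f x.
Proof.
by move=> Mx; rewrite -[in LHS](addr0 (a *: x)) bounded_opP ?bounded_op0 ?addr0 //;
  exact: subspace0.
Qed.
Lemma bounded_opN x : M x -> f (- x) = - f x.
Proof. by move=> Mx; rewrite -scaleN1r bounded_opZ // scaleN1r. Qed.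
Lemma bounded_opB x y : M x -> M y -> f (x - y) = f x - f y.
Proof. by move=> Mx My; rewrite bounded_opD ?bounded_opN //; exact: subspaceN. Qed.
End BoundedOperator.

Section Unitary.
Variables (M N : set H) (f : H -> H).
Hypothesis (uf : unitary_op dot M N f).
Lemma unitary_bop : bounded_op M N f.
Proof. by case: uf => g [[]]. Qed.
Lemma unitary_dot x y : M x -> M y -> dot (f x) (f y) = dot x y.
Proof.
move=> Mx My; case: uf => g [[b _ adj] gf _].
by rewrite adj ?gf //; exact: bounded_op_in b _ My.
Qed.
Lemma unitary_onto y : N y -> exists2 x, M x & f x = y.
Proof.
move=> Ny; case: uf => g [[_ b _] _ fg].
by exists (g y); [exact: bounded_op_in b _ Ny|exact: fg].
Qed.
End Unitary.

Hypothesis dot_norm : forall x : H, dot x x = `|x| ^+ 2.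

(** Preservation of inner products already forces linearity: expanding the
squared norm of f (a x + y) - a f x - f y gives that of (a x + y) - a x - y. *)
Lemma isometry_bounded M N f : subspace M -> (forall x, M x -> N (f x)) ->
  (forall x y, M x -> M y -> dot (f x) (f y) = dot x y) -> bounded_op M N f.
Proof.
move=> sM fMN fdot; split=> //.
  move=> a x y Mx My; apply/eqP; rewrite -subr_eq0; apply/eqP/(dot_eq0 (dot := dot)).
  have Mz := sM.2 a _ _ Mx My.
  by rewrite !dotE !fdot // !dotE; ring.
exists 1 => x Mx; rewrite mul1r -(@ler_pXn2r _ 2) ?nnegrE //.
by rewrite -!dot_norm fdot.
Qed.

(** The working criterion for unitarity: no linearity, bound or adjoint has to
be supplied, the adjoint being the inverse. *)
Lemma isometry_unitary M N f : subspace M -> subspace N ->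
  (forall x, M x -> N (f x)) ->
  (forall x y, M x -> M y -> dot (f x) (f y) = dot x y) ->
  (forall y, N y -> exists2 x, M x & f x = y) -> unitary_op dot M N f.
Proof.
move=> sM sN fMN fdot onto.
have /choice [g hg] : forall y, exists x, N y -> M x /\ f x = y.
  move=> y; have [Ny|nN] := pselect (N y); last by exists 0 => /nN.
  by have [x Mx fx] := onto _ Ny; exists x.
have gdot y z : N y -> N z -> dot (g y) (g z) = dot y z.
  by move=> /hg [My {2}<-] /hg [Mz {2}<-]; rewrite fdot.
have gNM y : N y -> M (g y) by case/hg.
have adj x y : M x -> N y -> dot (f x) y = dot x (g y).
  by move=> Mx /hg [My {1}<-]; rewrite fdot.
exists g; split; last by move=> y /hg [].
  by split=> //; apply: isometry_bounded.
move=> x Mx; apply/eqP; rewrite -subr_eq0; apply/eqP/(dot_eq0 (dot := dot)).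
have := gNM _ (fMN _ Mx) => Mg.
have e : dot x (g (f x)) = dot x x by rewrite -adj ?fdot //; exact: fMN.
have e' : dot (g (f x)) x = dot x x by rewrite dotC e -dotC.
by rewrite !dotE gdot ?fdot ?e ?e' //; [ring|exact: fMN..].
Qed.

(** * Orthonormal bases *)

Lemma hilbert_basis_exists M : exists B, hilbert_basis dot M B.
Proof.
have [F FP Ftot|B [[oB BM] Bmax]] :=
    Zorn_bigcup (P := [set B | orthonormal_set dot B /\ B `<=` M]).
  split=> [x y [X FX Xx] [Y FY Yy]|x [X /FP [_ XM] /XM]//].
  have [XY|YX] := Ftot _ _ FX FY.
    by apply: (FP _ FY).1 => //; exact: XY.
  by apply: (FP _ FX).1 => //; exact: YX.
exists B; split=> // C oC CM BC; apply/eqP; apply/negP => /negP CB.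
apply: (Bmax C) => //; rewrite properEneq; split=> //.
by rewrite eq_sym.
Qed.

(** Otherwise the normalization of z would enlarge the maximal set B. *)
Lemma hilbert_basis_total M B z : subspace M -> hilbert_basis dot M B ->
  M z -> (forall b, B b -> dot z b = 0) -> z = 0.
Proof.
move=> sM [oB BM Bmax] Mz zB; apply/eqP/negP => /negP z0.
have n0 : `|z| != 0 by rewrite normr_eq0.
pose e := `|z|^-1 *: z.
have c : (`|z|^-1)^*%R = `|z|^-1 by rewrite fmorphV /= (conj_Creal (normr_real z)).
have ee : dot e e = 1.
  by rewrite !dotE c dot_norm; field.
have eB b : B b -> dot e b = 0 by move=> Bb; rewrite dotE zB // mulr0.
have neB b : B b -> b == e = false.
  move=> Bb; apply/eqP => be; have := eB b Bb.
  by rewrite be ee; apply/eqP; exact: oner_neq0.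
have : B e.
  rewrite -(Bmax (B `|` [set e])); first by right.
  - move=> x y [Bx|->] [By|->]; first exact: oB.
    + by rewrite neB // (dot_sym0 (eB _ Bx)).
    + by rewrite eq_sym neB // eB.
    + by rewrite ee eqxx.
  - by move=> x [/BM //|->]; exact: subspaceZ.
  - by move=> x; left.
by move/eB; rewrite ee; apply/eqP; exact: oner_neq0.
Qed.

Lemma unitary_same_dim M N f : unitary_op dot M N f -> same_dim dot M N.
Proof.
move=> uf; have [B [oB BM Bmax]] := hilbert_basis_exists M.
have fdot := unitary_dot uf; case: uf => g [[bf bg adj] gf fg].
have finj : {in B &, injective f}.
  by move=> x y /set_mem /BM Mx /set_mem /BM My fxy; rewrite -(gf x) // fxy gf.
exists B, (f @` B); split.
- by split.
- split.
  + move=> _ _ [x Bx <-] [y By <-]; rewrite fdot; [|exact: BM|exact: BM].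
    rewrite oB //; congr (nat_of_bool _)%:R; apply/eqP/eqP => [->//|].
    by apply: finj; exact/mem_set.
  + by move=> _ [x /BM Mx <-]; exact: bounded_op_in bf _ Mx.
  + move=> C oC CN BC.
    have gC : g @` C = B.
      apply: Bmax.
      * move=> _ _ [x Cx <-] [y Cy <-]; have Nx := CN _ Cx; have Ny := CN _ Cy.
        rewrite -adj ?fg //; last exact: bounded_op_in bg _ Nx.
        rewrite oC //; congr (nat_of_bool _)%:R; apply/eqP/eqP => [->//|].
        by move=> gxy; rewrite -(fg x) // gxy fg.
      * by move=> _ [x /CN Nx <-]; exact: bounded_op_in bg _ Nx.
      * move=> x Bx; exists (f x); last by rewrite gf //; exact: BM.
        by apply: BC; exists x.
    apply/seteqP; split=> // c Cc; exists (g c); last by rewrite fg //; exact: CN.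
    by rewrite -gC; exists c.
- by rewrite card_eq_sym; apply: inj_card_eq.
Qed.

(** The closed linear relation generated by r, defined inductively so that
properties of its pairs follow by induction, without finite sums. *)

Inductive span_closure (r : H -> H -> Prop) : H -> H -> Prop :=
| sc_in x y : r x y -> span_closure r x y
| sc_zero : span_closure r 0 0
| sc_lin a x y x' y' : span_closure r x y -> span_closure r x' y' ->
    span_closure r (a *: x + x') (a *: y + y')
| sc_lim (u v : nat -> H) x y : (forall n, span_closure r (u n) (v n)) ->
    u @ \oo --> x -> v @ \oo --> y -> span_closure r x y.

Lemma span_closure_in r M N x y : subspace M -> seq_closed M -> subspace N ->
  seq_closed N -> (forall x y, r x y -> M x /\ N y) ->
  span_closure r x y -> M x /\ N y.
Proof.
move=> sM cM sN cN rMN; elim=> {x y}.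
- by move=> x y; exact: rMN.
- by split; exact: subspace0.
- by move=> a x y x' y' _ [? ?] _ [? ?]; split; [apply: sM.2|apply: sN.2].
- by move=> u v x y _ h ux vy; split; [apply: cM ux => n|apply: cN vy => n];
  case: (h n).
Qed.

Lemma span_closure_sym r x y :
  span_closure r x y -> span_closure (fun x y => r y x) y x.
Proof.
elim=> {x y}.
- by move=> x y ?; apply: sc_in.
- exact: sc_zero.
- by move=> a x y x' y' _ ? _ ?; apply: sc_lin.
- by move=> u v x y _ h ux vy; apply: sc_lim h vy ux.
Qed.

Lemma span_closure_dot_gen r x' y' x y :
  (forall x y, r x y -> dot x x' = dot y y') ->
  span_closure r x y -> dot x x' = dot y y'.
Proof.
move=> rdot; elim=> {x y}.
- by [].
- by rewrite !dotE.
- by move=> a x y z t _ e1 _ e2; rewrite !dotE e1 e2.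
- move=> u v x y _ e ux vy.
  have := cvg_dotl dot_norm (y := x') ux; under eq_fun do rewrite e.
  move=> h; apply: (cvg_unique (@norm_hausdorff _ _) h).
  exact: cvg_dotl.
Qed.

Lemma span_closure_dot r x' y' x y :
  (forall x y x' y', r x y -> r x' y' -> dot x x' = dot y y') ->
  span_closure r x y -> span_closure r x' y' -> dot x x' = dot y y'.
Proof.
move=> rdot c c'; apply: span_closure_dot_gen c => {}x {}y rxy.
rewrite (dotC dot x) (dotC dot y); congr (_^*%R).
by apply: span_closure_dot_gen c' => {}x' {}y' ?; exact: rdot.
Qed.

(** The relation is isometric, so its second components form a Cauchy sequence
when the first ones do: its domain is closed.  The component of x orthogonal to
the domain is orthogonal to the basis B, hence zero. *)
Lemma span_closure_total r M N B x : subspace M -> hilbert_basis dot M B ->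
  subspace N -> seq_closed M -> seq_closed N ->
  (forall x y, r x y -> M x /\ N y) ->
  (forall b, B b -> exists y, r b y) ->
  (forall x y x' y', r x y -> r x' y' -> dot x x' = dot y y') ->
  M x -> exists y, span_closure r x y.
Proof.
move=> sM hB sN cM cN rMN rB rdot Mx.
pose D := [set x | exists y, span_closure r x y].
have sD : subspace D.
  split; first by exists 0; exact: sc_zero.
  by move=> a y z [y' hy] [z' hz]; exists (a *: y' + z'); exact: sc_lin.
have cD : seq_closed D.
  move=> u z /choice [v hv] uz.
  have [t vt] : exists t : H, v @ \oo --> t.
    apply: cauchy_nr_cvg => e e0; have e2 : 0 < e / 2 by rewrite divr_gt0.
    have [k _ hk] := nr_cvg uz e2.
    exists k => m n km kn.
    have -> : nr (v m - v n) = nr (u m - u n).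
      have hs := sc_lin (-1) (hv n) (hv m).
      rewrite !scaleN1r ![- _ + _]addrC in hs.
      by rewrite /nr; congr (complex.Re _); apply/eqP;
        rewrite -(@eqrXn2 _ 2) // -!dot_norm; apply/eqP;
        rewrite (span_closure_dot rdot hs hs).
    have := hk _ km; have := hk _ kn; rewrite /= => h1 h2.
    by apply: le_lt_trans (nr_dist _ _ z) _; lra.
  by exists t; apply: sc_lim hv uz vt.
have [m Dm xm] := projection dot_norm x sD cD.
have Mm : M m by have [m' h] := Dm; case: (span_closure_in sM cM sN cN rMN h).
suff xm0 : x - m = 0 by move/eqP: xm0; rewrite subr_eq0 => /eqP ->.
apply: (hilbert_basis_total sM hB (subspaceB sM Mx Mm)) => b Bb; apply: xm.
by have [y ry] := rB _ Bb; exists y; exact: sc_in.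
Qed.

(** The unitary is the closed linear relation generated by a bijection of
bases; surjectivity is totality of the converse relation. *)
Lemma same_dim_unitary M N : subspace M -> seq_closed M -> subspace N ->
  seq_closed N -> same_dim dot M N -> exists V, unitary_op dot M N V.
Proof.
move=> sM cM sN cN [B [C [hB hC /card_set_bijP [f [fBC finj fonto]]]]].
pose r x y := B x /\ y = f x.
have [oB BM _] := hB; have [oC CN _] := hC.
have rMN x y : r x y -> M x /\ N y.
  by move=> [Bx ->]; split; [exact: BM|apply: CN; exact: fBC].
have rdot x y x' y' : r x y -> r x' y' -> dot x x' = dot y y'.
  move=> [Bx ->] [Bx' ->]; rewrite oB // oC ?fBC //; try exact: fBC.
  congr (nat_of_bool _)%:R; apply/eqP/eqP => [->//|].
  by apply: finj; exact/mem_set.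
have /choice [V hV] : forall x, exists y, M x -> span_closure r x y.
  move=> x; have [Mx|nM] := pselect (M x); last by exists 0 => /nM.
  have [y hy] := span_closure_total sM hB sN cM cN rMN
    (fun b Bb => ex_intro _ (f b) (conj Bb erefl)) rdot Mx.
  by exists y.
exists V; apply: isometry_unitary => //.
- by move=> x /hV h; case: (span_closure_in sM cM sN cN rMN h).
- by move=> x y /hV hx /hV hy; rewrite (span_closure_dot rdot hx hy).
- move=> y Ny.
  have [x /span_closure_sym hx] : exists x, span_closure (fun x y => r y x) y x.
    apply: (span_closure_total (M := N) (N := M) (B := C)) => //.
    + by move=> x1 y1 /rMN [? ?]; split.
    + by move=> c /fonto [b Bb <-]; exists b.
    + by move=> y1 x1 y2 x2 h1 h2; rewrite (rdot _ _ _ _ h1 h2).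
  have [Mx _] := span_closure_in sM cM sN cN rMN hx.
  exists x => //; apply/eqP; rewrite -subr_eq0; apply/eqP/(dot_eq0 (dot := dot)).
  have h := sc_lin (-1) hx (hV _ Mx); rewrite !scaleN1r ![- _ + _]addrC in h.
  by rewrite -(span_closure_dot rdot h h) subrr dot0l.
Qed.
End LinearMaps.

(** * Commutation with a positive square root *)

Section PositiveOperators.
Variables (R : realType) (H : completeNormedModType R[i]).
Variable dot : {dot H for @Num.conj R[i]}.
Hypothesis dot_norm : forall x : H, dot x x = `|x| ^+ 2.
Variable M : set H.
Hypothesis sM : subspace M.
Implicit Types (x y z : H) (T X : H -> H).
Local Notation dr := (dr dot).

Lemma bounded_nr T : bounded_op M M T ->
  exists2 k : R, 0 <= k & forall x, M x -> nr (T x) <= k * nr x.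
Proof.
case=> _ _ [k hk]; exists `|complex.Re k| => // x /hk; rewrite !nrE.
case: k {hk} => p q; rewrite lecE /= => /andP[_].
rewrite mulr0 oppr0 addr0 => /le_trans; apply.
by apply: ler_wpM2r; rewrite ?nr_ge0 // ler_norm.
Qed.

(** Polarization: <T z, z> is real at z = x + y and at z = ix + y. *)
Lemma positive_sym T x y : positive_op dot M T -> M x -> M y ->
  dot (T x) y = dot x (T y).
Proof.
move=> [bT pT] Mx My.
have imT z : M z -> complex.Im (dot (T z) z) = 0 by move/pT/ger0_Im.
have := imT _ (subspaceD sM Mx My); have := imT _ (sM.2 'i%C _ _ Mx My).
rewrite (bounded_opD bT) // (bounded_opP bT) // (dotC dot x (T y)) !dotE.
have := imT _ Mx; have := imT _ My.
case: (dot (T x) y) => a b; case: (dot (T y) x) => c d.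
case: (dot (T x) x) => e f; case: (dot (T y) y) => g h /=.
by move=> -> -> h1 h2; apply/eqP; rewrite eq_complex /=; apply/andP; split;
  apply/eqP; lra.
Qed.

Section PositiveContraction.
Variable T : H -> H.
Hypotheses (pT : positive_op dot M T) (cT : forall x, M x -> nr (T x) <= nr x).
Let bT := pT.1.
Let MT x : M x -> M (T x). Proof. exact: bounded_op_in bT x. Qed.

Lemma dr_sym x y : M x -> M y -> dr (T x) y = dr x (T y).
Proof. by move=> Mx My; congr complex.Re; exact: (positive_sym pT). Qed.

Lemma dr_pos x : M x -> 0 <= dr (T x) x.
Proof. by move=> Mx; have := pT.2 _ Mx; rewrite lecE /= => /andP[]. Qed.

Lemma contraction_dr x : M x -> dr (T x) (T x) <= dr x x.
Proof.
by move=> Mx; rewrite -!(nr_sqr dot_norm) ler_pXn2r ?nnegrE ?nr_ge0 ?cT.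
Qed.

(** T^2 <= T: this is 0 <= <T (x - T x), x - T x> combined with
<T y, y> <= |y|^2 at y = T x. *)
Lemma dr_sqr_le x : M x -> dr (T x) (T x) <= dr (T x) x.
Proof.
move=> Mx; have MTx := MT Mx; have MTTx := MT MTx.
have h1 := dr_pos (subspaceB sM Mx MTx).
have h2 := dr_ge0 dot_norm (T x - T (T x)).
have h3 := contraction_dr MTx.
move: h1 h2; rewrite (bounded_opB sM bT) // !drE.
rewrite (dr_sym MTx Mx) (drC _ (T x) (T (T x))) //; lra.
Qed.

Lemma subT_contraction x : M x -> nr (x - T x) <= nr x.
Proof.
move=> Mx; rewrite -(ler_pXn2r (n := 2)) ?nnegrE ?nr_ge0 // !(nr_sqr dot_norm).
have := dr_sqr_le Mx; have := dr_pos Mx.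
rewrite !drE (drC _ x (T x)) //; lra.
Qed.

(** The energy <T w, w> does not decrease along w = (1 + T)^n z, and each step
adds at least twice this energy to |w|^2. *)
Lemma iter_addT_growth z n : M z ->
  let w := iter n (fun u => u + T u) z in
  [/\ M w, dr (T z) z <= dr (T w) w & n%:R * (2 * dr (T z) z) <= dr w w].
Proof.
move=> Mz /=; elim: n => [|n /= [Mw h1 h2]].
  by split=> //=; rewrite mul0r dr_ge0.
move: (iter n _ z) Mw h1 h2 => w Mw h1 h2; have MTw := MT Mw.
have p1 := dr_ge0 dot_norm (T w); have p2 := dr_pos MTw.
split; first exact: subspaceD.
  by rewrite (bounded_opD bT) // !drE (dr_sym MTw Mw); lra.
by rewrite !drE (drC _ w (T w)) // -natr1; lra.
Qed.

(** Y turns the bounded sequence (1 - T)^n x into (1 + T)^n (Y x), whose squared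
norm grows at least like 2 n <T Y x, Y x>. *)
Lemma anticommute_eq0 Y (k : R) :
  (forall x, M x -> M (Y x)) ->
  (forall x y, M x -> M y -> Y (x - y) = Y x - Y y) ->
  (forall x, M x -> nr (Y x) <= k * nr x) ->
  (forall x, M x -> Y (T x) = - T (Y x)) ->
  forall x, M x -> T (Y x) = 0.
Proof.
move=> MY YB Yk YT x Mx.
pose w n := iter n (fun u => u - T u) x.
have Mw n : M (w n) /\ nr (w n) <= nr x.
  elim: n => [//|n [Mw le]]; split; first exact: subspaceB (MT Mw).
  exact: le_trans (subT_contraction Mw) le.
have Yw n : Y (w n) = iter n (fun u => u + T u) (Y x).
  elim: n => [//|n IH]; have [Mwn _] := Mw n.
  by rewrite /= -IH -/(w n) YB ?YT ?opprK //; exact: MT.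
have MYx := MY _ Mx.
have le n : n%:R * (2 * dr (T (Y x)) (Y x)) <= (`|k| * nr x) ^+ 2.
  have [_ _ h] := iter_addT_growth n MYx; apply: le_trans h _; rewrite -Yw.
  have [Mwn wn] := Mw n.
  rewrite -(nr_sqr dot_norm) ler_pXn2r ?nnegrE ?mulr_ge0 ?nr_ge0 //.
  apply: le_trans (Yk _ Mwn) _; apply: le_trans (ler_wpM2l (normr_ge0 k) wn).
  by apply: ler_wpM2r; rewrite ?nr_ge0 // ler_norm.
have b0 : dr (T (Y x)) (Y x) <= 0.
  rewrite leNgt; apply/negP => b0.
  have p : 0 < 2 * dr (T (Y x)) (Y x) by rewrite mulr_gt0.
  have := truncnS_gt ((`|k| * nr x) ^+ 2 / (2 * dr (T (Y x)) (Y x))).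
  by rewrite ltr_pdivrMr // ltNge le.
apply: (dr_eq0 dot_norm); apply/le_anti; rewrite dr_ge0 // andbT.
exact: le_trans (dr_sqr_le MYx) b0.
Qed.

(** The commutator Y = X T - T X satisfies Y T + T Y = X T^2 - T^2 X = 0. *)
Lemma commute_of_commute_sqr X : bounded_op M M X ->
  (forall x, M x -> T x = 0 -> x = 0) ->
  (forall x, M x -> X (T (T x)) = T (T (X x))) ->
  forall x, M x -> X (T x) = T (X x).
Proof.
move=> bX injT XT2 x Mx.
have MX y : M y -> M (X y) := bounded_op_in bX (x := y).
pose Y y := X (T y) - T (X y).
suff Y0 : Y x = 0 by apply/eqP; rewrite -subr_eq0; apply/eqP.
have MY y : M y -> M (Y y).
  by move=> My; apply: subspaceB => //; [exact/MX/MT|exact/MT/MX].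
apply: injT; first exact: MY.
have [k k0 hk] := bounded_nr bX.
apply: (anticommute_eq0 (Y := Y) (k := 2 * k)) => // [y z My Mz|y My|y My].
- rewrite /Y (bounded_opB sM bT) // (bounded_opB sM bX) //; try exact: MT.
  by rewrite (bounded_opB sM bX) // (bounded_opB sM bT) //; try exact: MX;
    rewrite !opprD !opprK addrACA.
- have := nr_dist (X (T y)) (T (X y)) 0; rewrite !sub0r !nrN => /le_trans; apply.
  have k1 := hk _ (MT My); have k2 := cT (MX _ My); have k3 := hk _ My.
  by have := ler_wpM2l k0 (cT My); lra.
- by rewrite /Y (bounded_opB sM bT) ?XT2 ?opprB //; [exact/MX/MT|exact/MT/MX].
Qed.
End PositiveContraction.
End PositiveOperators.

(** * Restrictions of unitary operators *)

Section Restriction.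
Variables (R : realType) (H : completeNormedModType R[i]).
Variable dot : {dot H for @Num.conj R[i]}.
Hypothesis dot_norm : forall x : H, dot x x = `|x| ^+ 2.

Lemma subspaceT : subspace [set: H].
Proof. by []. Qed.

Lemma unitary_inj M N f x y : unitary_op dot M N f -> M x -> M y ->
  f x = f y -> x = y.
Proof.
by move=> [g [_ gf _]] Mx My fxy; rewrite -(gf x) // fxy gf.
Qed.

Lemma unitary_restrict U M N : unitary_op dot setT setT U -> subspace M ->
  subspace N -> (forall x, M x <-> N (U x)) -> unitary_op dot M N U.
Proof.
move=> uU sM sN MN; apply: isometry_unitary => // [x /MN //|x y _ _|y Ny].
  exact: (unitary_dot uU).
by have [x _ xy] := unitary_onto uU (I : setT y); exists x => //; apply/MN; rewrite xy.
Qed.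
End Restriction.

(** * The six subspaces of a pair of projections *)

Section TwoProjections.
Variables (R : realType) (H : completeNormedModType R[i]).
Variable dot : {dot H for @Num.conj R[i]}.
Hypothesis dot_norm : forall x : H, dot x x = `|x| ^+ 2.
Implicit Types (x y z : H) (a : R[i]) (A E : set H).

Section OneProjection.
Variable P : H -> H.
Hypothesis projP : orthogonal_projection dot P.

Lemma proj_bop : bounded_op setT setT P.
Proof. by case: projP => -[]. Qed.

Lemma proj_sym x y : dot (P x) y = dot x (P y).
Proof. by case: projP => -[_ _ h] _; exact: h. Qed.

Lemma rangeE x : range P x <-> P x = x.
Proof.
split=> [[y _ <-]|<-]; last by exists x.
by case: projP => _ /(congr1 (@^~ y)).
Qed.

(** P is symmetric, so the range of P is the orthogonal complement of the range
of 1 - P. *)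
Lemma range_ortho : range P = ortho dot [set y - P y | y in setT].
Proof.
apply/seteqP; split=> x.
  by move=> /rangeE Px _ [y _ <-]; rewrite dotDr dotNr -proj_sym Px subrr.
move=> h; apply/rangeE/esym/eqP; rewrite -subr_eq0; apply/eqP.
apply: (dot_eq0 (dot := dot)); set z := x - P x.
have Pz : P z = 0.
  rewrite /z (bounded_opB (M := setT) _ proj_bop) //.
  by case: projP => _ /(congr1 (@^~ x)) /= ->; rewrite subrr.
rewrite {1}/z dotDl dotNl proj_sym Pz dot0r subr0.
by rewrite -(subr0 z) -Pz; apply: h; exists z.
Qed.

Lemma nullspace_ortho : nullspace P = ortho dot (range P).
Proof.
apply/seteqP; split=> x.
  by move=> Px _ [y _ <-]; rewrite -proj_sym Px dot0l.
move=> h; apply: (dot_eq0 (dot := dot)); rewrite -proj_sym.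
by apply: dot_sym0; apply: h; exists (P x).
Qed.

Lemma range_null_orth x y : range P x -> nullspace P y -> dot x y = 0.
Proof. by rewrite nullspace_ortho => Px h; apply: dot_sym0; exact: h. Qed.

End OneProjection.

Lemma ortho_closed_subspace A : closed_subspace (ortho dot A).
Proof. by split; [exact: ortho_subspace|exact: ortho_closed]. Qed.

Lemma closed_subspaceI A E :
  closed_subspace A -> closed_subspace E -> closed_subspace (A `&` E).
Proof.
move=> [[A0 AP] cA] [[E0 EP] cE]; split; [split|] => //.
- by move=> a x y [? ?] [? ?]; split; [apply: AP|apply: EP].
- by move=> u x h ux; split; [apply: cA ux => n|apply: cE ux => n]; case: (h n).
Qed.

Variables P Q : H -> H.
Hypothesis projP : orthogonal_projection dot P.
Hypothesis projQ : orthogonal_projection dot Q.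
Local Notation M1 := (H1 P Q).
Local Notation M2 := (H2 P Q).
Local Notation M3 := (H3 P Q).
Local Notation M4 := (H4 P Q).
Local Notation M5 := (H5 dot P Q).
Local Notation M6 := (H6 dot P Q).

Lemma H1P x : M1 x <-> P x = x /\ Q x = x.
Proof. by split=> -[/(rangeE projP) ? /(rangeE projQ) ?]. Qed.
Lemma H2P x : M2 x <-> P x = x /\ Q x = 0.
Proof. by split=> -[/(rangeE projP) ? ?]. Qed.
Lemma H3P x : M3 x <-> P x = 0 /\ Q x = x.
Proof. by split=> -[? /(rangeE projQ) ?]. Qed.
Lemma H4P x : M4 x <-> P x = 0 /\ Q x = 0.
Proof. by []. Qed.

Lemma range_closed_subspace P' :
  orthogonal_projection dot P' -> closed_subspace (range P').
Proof. by move=> h; rewrite range_ortho //; exact: ortho_closed_subspace. Qed.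
Lemma nullspace_closed_subspace P' :
  orthogonal_projection dot P' -> closed_subspace (nullspace P').
Proof. by move=> h; rewrite nullspace_ortho //; exact: ortho_closed_subspace. Qed.

Lemma H1_closed : closed_subspace M1.
Proof. by apply: closed_subspaceI; exact: range_closed_subspace. Qed.
Lemma H2_closed : closed_subspace M2.
Proof.
apply: closed_subspaceI; [exact: range_closed_subspace|].
exact: nullspace_closed_subspace.
Qed.
Lemma H3_closed : closed_subspace M3.
Proof.
apply: closed_subspaceI; [|exact: range_closed_subspace].
exact: nullspace_closed_subspace.
Qed.
Lemma H4_closed : closed_subspace M4.
Proof. by apply: closed_subspaceI; exact: nullspace_closed_subspace. Qed.
Lemma H5_closed : closed_subspace M5.
Proof.
apply: (closed_subspaceI (range_closed_subspace projP)).
exact: ortho_closed_subspace.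
Qed.
Lemma H6_closed : closed_subspace M6.
Proof.
suff -> : M6 = ortho dot (hsum (hsum (hsum (hsum M1 M2) M3) M4) M5).
  exact: ortho_closed_subspace.
by apply/seteqP; split=> x => [[_ h]|h].
Qed.

Let s1 : subspace M1. Proof. exact: H1_closed.1. Qed.
Let s2 : subspace M2. Proof. exact: H2_closed.1. Qed.
Let s3 : subspace M3. Proof. exact: H3_closed.1. Qed.
Let s4 : subspace M4. Proof. exact: H4_closed.1. Qed.
Let s5 : subspace M5. Proof. exact: H5_closed.1. Qed.
Let s6 : subspace M6. Proof. exact: H6_closed.1. Qed.

Lemma H5P x : M5 x <-> [/\ P x = x, forall y, M1 y -> dot x y = 0
                         & forall y, M2 y -> dot x y = 0].
Proof.
split=> [[/(rangeE projP) Px h]|[/(rangeE projP) Px h1 h2]].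
  split=> // y My; apply: h.
    by exists y => //; exists 0; [exact: subspace0 s2|rewrite addr0].
  by exists 0; [exact: subspace0 s1|exists y => //; rewrite add0r].
by split=> // _ [y /h1 Hy [z /h2 Hz <-]]; rewrite dotDr Hy Hz addr0.
Qed.

Lemma H6P x : M6 x <->
  [/\ forall y, M1 y -> dot x y = 0, forall y, M2 y -> dot x y = 0,
      forall y, M3 y -> dot x y = 0, forall y, M4 y -> dot x y = 0
    & forall y, M5 y -> dot x y = 0].
Proof.
have [z1 z2 z3 z4 z5] :=
  And5 (subspace0 s1) (subspace0 s2) (subspace0 s3) (subspace0 s4) (subspace0 s5).
split=> [[_ h]|[h1 h2 h3 h4 h5]].
  have h' y1 y2 y3 y4 y5 : M1 y1 -> M2 y2 -> M3 y3 -> M4 y4 -> M5 y5 ->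
      dot x (y1 + y2 + y3 + y4 + y5) = 0.
    move=> ? ? ? ? ?; apply: h; exists (y1 + y2 + y3 + y4); last by exists y5.
    exists (y1 + y2 + y3); last by exists y4.
    exists (y1 + y2); last by exists y3.
    by exists y1 => //; exists y2.
  split=> y My.
  - by have := h' _ _ _ _ _ My z2 z3 z4 z5; rewrite !addr0.
  - by have := h' _ _ _ _ _ z1 My z3 z4 z5; rewrite !addr0 !add0r.
  - by have := h' _ _ _ _ _ z1 z2 My z4 z5; rewrite !addr0 !add0r.
  - by have := h' _ _ _ _ _ z1 z2 z3 My z5; rewrite !addr0 !add0r.
  - by have := h' _ _ _ _ _ z1 z2 z3 z4 My; rewrite !addr0 !add0r.
split=> // _ [_ [_ [_ [y1 ? [y2 ? <-]] [y3 ? <-]] [y4 ? <-]] [y5 ? <-]].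
by rewrite !dotE h1 // h2 // h3 // h4 // h5 // !addr0.
Qed.

Lemma orth12 x y : M1 x -> M2 y -> dot x y = 0.
Proof. by move=> [_ h] [_ h']; exact: range_null_orth projQ _ _ h h'. Qed.
Lemma orth13 x y : M1 x -> M3 y -> dot x y = 0.
Proof. by move=> [h _] [h' _]; exact: range_null_orth projP _ _ h h'. Qed.
Lemma orth14 x y : M1 x -> M4 y -> dot x y = 0.
Proof. by move=> [h _] [h' _]; exact: range_null_orth projP _ _ h h'. Qed.
Lemma orth23 x y : M2 x -> M3 y -> dot x y = 0.
Proof. by move=> [h _] [h' _]; exact: range_null_orth projP _ _ h h'. Qed.
Lemma orth24 x y : M2 x -> M4 y -> dot x y = 0.
Proof. by move=> [h _] [h' _]; exact: range_null_orth projP _ _ h h'. Qed.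
Lemma orth34 x y : M3 x -> M4 y -> dot x y = 0.
Proof. by move=> [_ h] [_ h']; exact: range_null_orth projQ _ _ h h'. Qed.
Lemma orth51 x y : M5 x -> M1 y -> dot x y = 0.
Proof. by move=> /H5P [_ h _]; exact: h. Qed.
Lemma orth52 x y : M5 x -> M2 y -> dot x y = 0.
Proof. by move=> /H5P [_ _ h]; exact: h. Qed.
Lemma orth53 x y : M5 x -> M3 y -> dot x y = 0.
Proof. by move=> [h _] [h' _]; exact: range_null_orth projP _ _ h h'. Qed.
Lemma orth54 x y : M5 x -> M4 y -> dot x y = 0.
Proof. by move=> [h _] [h' _]; exact: range_null_orth projP _ _ h h'. Qed.
Lemma orth61 x y : M6 x -> M1 y -> dot x y = 0.
Proof. by move=> /H6P [h _ _ _ _]; exact: h. Qed.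
Lemma orth62 x y : M6 x -> M2 y -> dot x y = 0.
Proof. by move=> /H6P [_ h _ _ _]; exact: h. Qed.
Lemma orth63 x y : M6 x -> M3 y -> dot x y = 0.
Proof. by move=> /H6P [_ _ h _ _]; exact: h. Qed.
Lemma orth64 x y : M6 x -> M4 y -> dot x y = 0.
Proof. by move=> /H6P [_ _ _ h _]; exact: h. Qed.
Lemma orth65 x y : M6 x -> M5 y -> dot x y = 0.
Proof. by move=> /H6P [_ _ _ _ h]; exact: h. Qed.

Definition components x1 x2 x3 x4 x5 x6 :=
  [/\ M1 x1, M2 x2 & M3 x3] /\ [/\ M4 x4, M5 x5 & M6 x6].

Lemma dot_components x1 x2 x3 x4 x5 x6 y1 y2 y3 y4 y5 y6 :
  components x1 x2 x3 x4 x5 x6 -> components y1 y2 y3 y4 y5 y6 ->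
  dot (x1 + x2 + x3 + x4 + x5 + x6) (y1 + y2 + y3 + y4 + y5 + y6) =
  dot x1 y1 + dot x2 y2 + dot x3 y3 + dot x4 y4 + dot x5 y5 + dot x6 y6.
Proof.
move=> [[X1 X2 X3] [X4 X5 X6]] [[Y1 Y2 Y3] [Y4 Y5 Y6]]; rewrite !dotE.
rewrite (orth12 X1 Y2) (dot_sym0 (orth12 Y1 X2))
  (orth13 X1 Y3) (dot_sym0 (orth13 Y1 X3)).
rewrite (orth14 X1 Y4) (dot_sym0 (orth14 Y1 X4))
  (orth23 X2 Y3) (dot_sym0 (orth23 Y2 X3)).
rewrite (orth24 X2 Y4) (dot_sym0 (orth24 Y2 X4))
  (orth34 X3 Y4) (dot_sym0 (orth34 Y3 X4)).
rewrite (orth51 X5 Y1) (dot_sym0 (orth51 Y5 X1))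
  (orth52 X5 Y2) (dot_sym0 (orth52 Y5 X2)).
rewrite (orth53 X5 Y3) (dot_sym0 (orth53 Y5 X3))
  (orth54 X5 Y4) (dot_sym0 (orth54 Y5 X4)).
rewrite (orth61 X6 Y1) (dot_sym0 (orth61 Y6 X1))
  (orth62 X6 Y2) (dot_sym0 (orth62 Y6 X2)).
rewrite (orth63 X6 Y3) (dot_sym0 (orth63 Y6 X3))
  (orth64 X6 Y4) (dot_sym0 (orth64 Y6 X4)).
by rewrite (orth65 X6 Y5) (dot_sym0 (orth65 Y6 X5)) !(addr0, add0r).
Qed.

(** What remains of x after subtracting its projections on H1, ..., H5 is
orthogonal to these five mutually orthogonal subspaces, so it lies in H6. *)
Lemma decomposition x : exists x1 x2 x3 x4 x5 x6,
  components x1 x2 x3 x4 x5 x6 /\ x = x1 + x2 + x3 + x4 + x5 + x6.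
Proof.
have [x1 X1 h1] := projection dot_norm x H1_closed.1 H1_closed.2.
have [x2 X2 h2] := projection dot_norm x H2_closed.1 H2_closed.2.
have [x3 X3 h3] := projection dot_norm x H3_closed.1 H3_closed.2.
have [x4 X4 h4] := projection dot_norm x H4_closed.1 H4_closed.2.
have [x5 X5 h5] := projection dot_norm x H5_closed.1 H5_closed.2.
exists x1, x2, x3, x4, x5, (x - (x1 + x2 + x3 + x4 + x5)).
split; last by rewrite addrC subrK.
split=> //; split=> //; apply/H6P; split=> y Y.
- have := h1 _ Y; rewrite dotDl dotNl => /eqP; rewrite subr_eq0 => /eqP h.
  rewrite !dotE h (dot_sym0 (orth12 Y X2)) (dot_sym0 (orth13 Y X3)).
  by rewrite (dot_sym0 (orth14 Y X4)) (orth51 X5 Y) !addr0 subrr.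
- have := h2 _ Y; rewrite dotDl dotNl => /eqP; rewrite subr_eq0 => /eqP h.
  rewrite !dotE h (orth12 X1 Y) (dot_sym0 (orth23 Y X3)).
  by rewrite (dot_sym0 (orth24 Y X4)) (orth52 X5 Y) !(addr0, add0r) subrr.
- have := h3 _ Y; rewrite dotDl dotNl => /eqP; rewrite subr_eq0 => /eqP h.
  rewrite !dotE h (orth13 X1 Y) (orth23 X2 Y).
  by rewrite (dot_sym0 (orth34 Y X4)) (orth53 X5 Y) !(addr0, add0r) subrr.
- have := h4 _ Y; rewrite dotDl dotNl => /eqP; rewrite subr_eq0 => /eqP h.
  rewrite !dotE h (orth14 X1 Y) (orth24 X2 Y).
  by rewrite (orth34 X3 Y) (orth54 X5 Y) !(addr0, add0r) subrr.
- have := h5 _ Y; rewrite dotDl dotNl => /eqP; rewrite subr_eq0 => /eqP h.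
  rewrite !dotE h (dot_sym0 (orth51 Y X1)) (dot_sym0 (orth52 Y X2)).
  by rewrite (dot_sym0 (orth53 Y X3)) (dot_sym0 (orth54 Y X4)) !(addr0, add0r) subrr.
Qed.

Lemma componentsB x1 x2 x3 x4 x5 x6 y1 y2 y3 y4 y5 y6 :
  components x1 x2 x3 x4 x5 x6 -> components y1 y2 y3 y4 y5 y6 ->
  components (x1 - y1) (x2 - y2) (x3 - y3) (x4 - y4) (x5 - y5) (x6 - y6).
Proof.
move=> [[? ? ?] [? ? ?]] [[? ? ?] [? ? ?]].
by do 2![split]; [apply: (subspaceB s1)|apply: (subspaceB s2)|apply: (subspaceB s3)
  |apply: (subspaceB s4)|apply: (subspaceB s5)|apply: (subspaceB s6)].
Qed.

(** Uniqueness of components: |x|^2 is the sum of the six |xi|^2. *)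
Lemma components_eq0 x1 x2 x3 x4 x5 x6 : components x1 x2 x3 x4 x5 x6 ->
  x1 + x2 + x3 + x4 + x5 + x6 = 0 ->
  [/\ x1 = 0, x2 = 0 & x3 = 0] /\ [/\ x4 = 0, x5 = 0 & x6 = 0].
Proof.
move=> X X0; have := dot_components X X;
  rewrite X0 dot0l !(dot_dr dot_norm) -!rmorphD /=.
have p y := dr_ge0 dot_norm y.
move=> /(congr1 (@complex.Re R)) /= /esym h.
have z y : dr dot y y <= 0 -> y = 0.
  by move=> le; apply: (dr_eq0 dot_norm); apply/le_anti; rewrite le p.
have := p x1; have := p x2; have := p x3; have := p x4; have := p x5; have := p x6.
by move=> *; do 2![split]; apply: z; lra.
Qed.

Lemma sum_of_differences (a b c d : H) : a - b + (c - d) = a + c - (b + d).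
Proof. by rewrite opprD addrACA. Qed.

(** An operator may be prescribed freely on components, as these are unique. *)
Lemma acts_as_exists F : exists f, acts_as dot P Q f F.
Proof.
have /choice [f hf] : forall x, exists y, exists x1 x2 x3 x4 x5 x6,
    [/\ components x1 x2 x3 x4 x5 x6, x = x1 + x2 + x3 + x4 + x5 + x6
      & y = F x1 x2 x3 x4 x5 x6].
  move=> x; have [x1 [x2 [x3 [x4 [x5 [x6 [X xE]]]]]]] := decomposition x.
  by exists (F x1 x2 x3 x4 x5 x6), x1, x2, x3, x4, x5, x6.
exists f => x1 x2 x3 x4 x5 x6 X1 X2 X3 X4 X5 X6.
have [y1 [y2 [y3 [y4 [y5 [y6 [Y e ->]]]]]]] := hf (x1 + x2 + x3 + x4 + x5 + x6).
have X : components x1 x2 x3 x4 x5 x6 by [].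
have /eqP := e; rewrite -subr_eq0 => /eqP s0.
have := components_eq0 (componentsB X Y); case.
  by rewrite !sum_of_differences.
by move=> [/subr0_eq -> /subr0_eq -> /subr0_eq ->]
  [/subr0_eq -> /subr0_eq -> /subr0_eq ->].
Qed.

(** * Operators given by matrices *)

Variables Q0 S T D Ds : H -> H.
Hypotheses (Q0_pos : positive_op dot M5 Q0)
  (Q0_eig0 : ~ is_eigenvalue M5 Q0 0) (Q0_eig1 : ~ is_eigenvalue M5 Q0 1)
  (S_sqrt : is_psqrt dot M5 Q0 S) (T_sqrt : is_psqrt dot M5 (idfun \- Q0) T)
  (D_unitary : unitary_op dot M6 M5 D) (Ds_adj : adjoint_op dot M6 M5 D Ds)
  (P_matrix : acts_as dot P Q P (fun x1 x2 x3 x4 x5 x6 =>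
       x1 + x2 + 0 + 0 + x5 + 0))
  (Q_matrix : acts_as dot P Q Q (fun x1 x2 x3 x4 x5 x6 =>
       x1 + 0 + x3 + 0
       + join2 (block2 Q0             (S \o T \o D)
                       (Ds \o S \o T) (Ds \o (idfun \- Q0) \o D) (x5, x6)))).

Let bS := S_sqrt.1.1.
Let bT := T_sqrt.1.1.
Let bD := unitary_bop D_unitary.
Let bDs : bounded_op M5 M6 Ds. Proof. by case: Ds_adj. Qed.
Let MS x : M5 x -> M5 (S x). Proof. exact: bounded_op_in bS x. Qed.
Let MT x : M5 x -> M5 (T x). Proof. exact: bounded_op_in bT x. Qed.
Let MD x : M6 x -> M5 (D x). Proof. exact: bounded_op_in bD x. Qed.
Let MDs x : M5 x -> M6 (Ds x). Proof. exact: bounded_op_in bDs x. Qed.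

Let SS x : M5 x -> S (S x) = Q0 x. Proof. exact: S_sqrt.2. Qed.
Let TT x : M5 x -> T (T x) = x - Q0 x. Proof. exact: T_sqrt.2. Qed.

(** Adjoints are unique, so Ds is the inverse that unitarity of D provides. *)
Lemma adjoint_inverse : (forall y, M5 y -> D (Ds y) = y) /\
  (forall x, M6 x -> Ds (D x) = x).
Proof.
case: D_unitary => g [[_ bg adj] gD Dg]; case: Ds_adj => _ _ adj'.
have gDs y : M5 y -> Ds y = g y.
  move=> My; apply/eqP; rewrite -subr_eq0; apply/eqP/(dot_eq0 (dot := dot)).
  have Mz : M6 (Ds y - g y) := subspaceB s6 (MDs My) (bounded_op_in bg My).
  by rewrite dotDr dotNr -adj // -adj' // subrr.
by split=> x Mx; rewrite gDs ?Dg ?gD //; exact: MD.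
Qed.
Let DDs := adjoint_inverse.1.
Let DsD := adjoint_inverse.2.

Lemma unitary_Ds : unitary_op dot M5 M6 Ds.
Proof.
apply: isometry_unitary => //.
- by move=> x y Mx My; rewrite -(unitary_dot D_unitary) ?DDs //; exact: MDs.
- by move=> y My; exists (D y); [exact: MD|exact: DsD].
Qed.

Lemma S_eq0 x : M5 x -> S x = 0 -> x = 0.
Proof.
move=> Mx Sx0; apply/eqP/negP => /negP x0; apply: Q0_eig0; exists x; split=> //.
by rewrite -SS // Sx0 (bounded_op0 s5 bS) scale0r.
Qed.

Lemma T_eq0 x : M5 x -> T x = 0 -> x = 0.
Proof.
move=> Mx Tx0; apply/eqP/negP => /negP x0; apply: Q0_eig1; exists x; split=> //.
apply/esym/eqP; rewrite -subr_eq0 scale1r.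
by rewrite -TT // Tx0 (bounded_op0 s5 bT).
Qed.

Lemma sqrS_add_sqrT x : M5 x -> S (S x) + T (T x) = x.
Proof. by move=> Mx; rewrite SS // TT // addrC subrK. Qed.

(** |S x|^2 + |T x|^2 = <(S^2 + T^2) x, x> = |x|^2. *)
Lemma S_T_contraction x : M5 x -> nr (S x) <= nr x /\ nr (T x) <= nr x.
Proof.
move=> Mx.
have h : dr dot (S x) (S x) + dr dot (T x) (T x) = dr dot x x.
  rewrite /dr -raddfD (positive_sym s5 S_sqrt.1) //; last exact: MS.
  rewrite (positive_sym s5 T_sqrt.1) //; last exact: MT.
  by rewrite -dotDr sqrS_add_sqrT.
have := dr_ge0 dot_norm (S x); have := dr_ge0 dot_norm (T x).
by split; rewrite -(ler_pXn2r (n := 2)) ?nnegrE ?nr_ge0 // !(nr_sqr dot_norm); lra.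
Qed.

(** The eigenvalue hypotheses on Q0 make S and T injective, which is what the
commutation lemma requires of a square root. *)
Lemma commute_sqrt X : bounded_op M5 M5 X ->
  (forall x, M5 x -> X (Q0 x) = Q0 (X x)) ->
  (forall x, M5 x -> X (S x) = S (X x)) /\ (forall x, M5 x -> X (T x) = T (X x)).
Proof.
move=> bX XQ; have MX x : M5 x -> M5 (X x) by move=> h; exact: (bounded_op_in bX).
have MQ x : M5 x -> M5 (Q0 x) by move=> h; exact: (bounded_op_in Q0_pos.1).
split.
  apply: (commute_of_commute_sqr dot_norm s5 S_sqrt.1 _ bX S_eq0).
    by move=> x /S_T_contraction [].
  by move=> x Mx; rewrite !SS ?XQ //; exact: MX.
apply: (commute_of_commute_sqr dot_norm s5 T_sqrt.1 _ bX T_eq0).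
  by move=> x /S_T_contraction [].
by move=> x Mx; rewrite !TT ?(bounded_opB s5 bX) ?XQ //; first [exact: MX|exact: MQ].
Qed.

(** S commutes with Q0 = S^2, hence with the square root T of 1 - Q0. *)
Lemma S_T_commute x : M5 x -> S (T x) = T (S x).
Proof.
have SQ0 y : M5 y -> S (Q0 y) = Q0 (S y).
  by move=> My; rewrite -!SS //; exact: MS.
exact: (commute_sqrt bS SQ0).2.
Qed.

Ltac mem5 := repeat first
  [ assumption | apply: (subspaceD s5) | apply: (subspaceN s5) | apply: MS | apply: MT
  | apply: MD | apply: MDs ].

Lemma P_components x1 x2 x3 x4 x5 x6 : components x1 x2 x3 x4 x5 x6 ->
  P (x1 + x2 + x3 + x4 + x5 + x6) = x1 + x2 + 0 + 0 + x5 + 0.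
Proof. by move=> [[? ? ?] [? ? ?]]; rewrite P_matrix. Qed.

(** On (x5, x6) the matrix of Q factors: with e = S x5 + T D x6 the components
are S e and D* T e, because S and T commute. *)
Lemma Q_components x1 x2 x3 x4 x5 x6 : components x1 x2 x3 x4 x5 x6 ->
  Q (x1 + x2 + x3 + x4 + x5 + x6) = x1 + 0 + x3 + 0
    + S (S x5 + T (D x6)) + Ds (T (S x5 + T (D x6))).
Proof.
move=> [[? ? ?] [? ? M]]; rewrite Q_matrix // /join2 /block2 /=.
have MDx := MD M; rewrite -(TT MDx) -SS //.
by rewrite (bounded_opD bS) ?(bounded_opD bT) ?(bounded_opD bDs) ?S_T_commute
  ?addrA //; mem5.
Qed.

Section Form.
Variables U1 C2 C3 U4 U0 : H -> H.
Hypotheses (u1 : unitary_op dot M1 M1 U1) (u2 : unitary_op dot M3 M2 C2)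
  (u3 : unitary_op dot M2 M3 C3) (u4 : unitary_op dot M4 M4 U4)
  (u0 : unitary_op dot M5 M5 U0)
  (U0Q0 : forall x, M5 x -> U0 (Q0 x) = Q0 (U0 x)).

Let MU1 x : M1 x -> M1 (U1 x). Proof. exact: bounded_op_in (unitary_bop u1) x. Qed.
Let MC2 x : M3 x -> M2 (C2 x). Proof. exact: bounded_op_in (unitary_bop u2) x. Qed.
Let MC3 x : M2 x -> M3 (C3 x). Proof. exact: bounded_op_in (unitary_bop u3) x. Qed.
Let MU4 x : M4 x -> M4 (U4 x). Proof. exact: bounded_op_in (unitary_bop u4) x. Qed.
Let MU0 x : M5 x -> M5 (U0 x). Proof. exact: bounded_op_in (unitary_bop u0) x. Qed.

Definition intertwining_form x1 x2 x3 x4 x5 x6 :=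
  U1 x1
  + join2 (block2 \0 C2
                  C3 \0 (x2, x3))
  + U4 x4
  + join2 (block2 S         (T \o D)
                  (Ds \o T) (\- (Ds \o S \o D))
            (block2 U0 \0
                    \0 (Ds \o U0 \o D) (x5, x6))).

Lemma intertwining_formE x1 x2 x3 x4 x5 x6 : components x1 x2 x3 x4 x5 x6 ->
  intertwining_form x1 x2 x3 x4 x5 x6 =
  U1 x1 + C2 x3 + C3 x2 + U4 x4 + (S (U0 x5) + T (U0 (D x6)))
    + Ds (T (U0 x5) - S (U0 (D x6))).
Proof.
move=> [[X1 X2 X3] [X4 X5 X6]]; rewrite /intertwining_form /join2 /block2 /=.
have Ma := MU0 X5; have Mc := MU0 (MD X6).
rewrite !(addr0, add0r) DDs // (bounded_opB s5 bDs); try by mem5.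
by rewrite !addrA.
Qed.

Variable U : H -> H.
Hypothesis U_form : acts_as dot P Q U intertwining_form.

Let U_components x1 x2 x3 x4 x5 x6 : components x1 x2 x3 x4 x5 x6 ->
  U (x1 + x2 + x3 + x4 + x5 + x6) =
  U1 x1 + C2 x3 + C3 x2 + U4 x4 + (S (U0 x5) + T (U0 (D x6)))
    + Ds (T (U0 x5) - S (U0 (D x6))).
Proof.
by move=> X; rewrite -intertwining_formE //; case: X => -[? ? ?] [? ? ?]; exact: U_form.
Qed.

Let components_U x1 x2 x3 x4 x5 x6 : components x1 x2 x3 x4 x5 x6 ->
  components (U1 x1) (C2 x3) (C3 x2) (U4 x4) (S (U0 x5) + T (U0 (D x6)))
    (Ds (T (U0 x5) - S (U0 (D x6)))).
Proof.
move=> [[X1 X2 X3] [X4 X5 X6]]; have Ma := MU0 X5; have Mc := MU0 (MD X6).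
split; split; [exact: MU1|exact: MC2|exact: MC3|exact: MU4|mem5..].
Qed.

(** The matrix (S, T; T, -S) on pairs of vectors of H5 is a self-adjoint
involution: it preserves inner products, and it is its own inverse. *)
Let rotation_dot (a c a' c' : H) : M5 a -> M5 c -> M5 a' -> M5 c' ->
  dot (S a + T c) (S a' + T c') + dot (T a - S c) (T a' - S c') =
  dot a a' + dot c c'.
Proof.
move=> Ma Mc Ma' Mc'; rewrite !dotE.
have symS := positive_sym s5 S_sqrt.1; have symT := positive_sym s5 T_sqrt.1.
rewrite !symS ?symT; try by mem5.
have -> : dot a a' = dot a (S (S a')) + dot a (T (T a')).
  by rewrite -dotDr sqrS_add_sqrT.
have -> : dot c c' = dot c (S (S c')) + dot c (T (T c')).
  by rewrite -dotDr sqrS_add_sqrT.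
rewrite !S_T_commute //; ring.
Qed.

Let rotation_sqr (a c : H) : M5 a -> M5 c ->
  prod (S (S a + T c) + T (T a - S c) = a) (T (S a + T c) - S (T a - S c) = c).
Proof.
move=> Ma Mc.
rewrite (bounded_opB s5 bT) ?(bounded_opB s5 bS) ?(bounded_opD bS)
  ?(bounded_opD bT); try by mem5.
rewrite !S_T_commute //; split; last first.
  by rewrite opprB (addrC (T (S a))) addrACA subrr addr0 addrC sqrS_add_sqrT.
by rewrite addrACA subrr addr0 sqrS_add_sqrT.
Qed.

(** Writing a = U0 x5, c = U0 D x6 and e = S x5 + T D x6, the last two components
of Q U x are S e' and D* T e' with e' = S (S a + T c) + T (T a - S c) = a, those
of U P x; and those of U Q x are S a + T c and 0, those of P U x, since U0
commutes with S and T. *)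
Lemma form_intertwining : intertwining dot P Q U.
Proof.
have z5 := subspace0 s5; have z6 := subspace0 s6.
have b0 := unitary_bop u0.
have [US UT] := commute_sqrt b0 U0Q0.
have zC2 := bounded_op0 s3 (unitary_bop u2).
have zC3 := bounded_op0 s2 (unitary_bop u3);
  have zU4 := bounded_op0 s4 (unitary_bop u4).
have zU0 := bounded_op0 s5 b0; have zS := bounded_op0 s5 bS;
  have zT := bounded_op0 s5 bT.
have zD := bounded_op0 s6 bD; have zDs := bounded_op0 s5 bDs.
split.
- apply: isometry_unitary => // [x y _ _|y _].
  + have [x1 [x2 [x3 [x4 [x5 [x6 [X ->]]]]]]] := decomposition x.
    have [y1 [y2 [y3 [y4 [y5 [y6 [Y ->]]]]]]] := decomposition y.
    rewrite !U_components // (dot_components (components_U X) (components_U Y))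
      (dot_components X Y).
    case: X Y => -[X1 X2 X3] [X4 X5 X6] [[Y1 Y2 Y3] [Y4 Y5 Y6]].
    have Ma := MU0 X5; have Mc := MU0 (MD X6).
    have Ma' := MU0 Y5; have Mc' := MU0 (MD Y6).
    rewrite (unitary_dot u1) // (unitary_dot u2) // (unitary_dot u3) //.
    rewrite (unitary_dot u4) // (unitary_dot unitary_Ds); try by mem5.
    rewrite -!addrA rotation_dot // (unitary_dot u0) // (unitary_dot u0); try by mem5.
    rewrite (unitary_dot D_unitary) //; ring.
  + have [y1 [y2 [y3 [y4 [y5 [y6 [[[Y1 Y2 Y3] [Y4 Y5 Y6]] ->]]]]]]] :=
      decomposition y.
    have [x1 X1 <-] := unitary_onto u1 Y1; have [x3 X3 <-] := unitary_onto u2 Y2.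
    have [x2 X2 <-] := unitary_onto u3 Y3; have [x4 X4 <-] := unitary_onto u4 Y4.
    have MDy := MD Y6.
    have [x5 X5 e5] : exists2 x, M5 x & U0 x = S y5 + T (D y6).
      by apply: (unitary_onto u0); mem5.
    have [x6 X6 e6] : exists2 x, M5 x & U0 x = T y5 - S (D y6).
      by apply: (unitary_onto u0); mem5.
    exists (x1 + x2 + x3 + x4 + x5 + Ds x6) => //; rewrite U_components; last first.
      by split; split => //; exact: MDs.
    by rewrite DDs // e5 e6 !(rotation_sqr Y5 MDy) DsD.
- apply/funext => x /=.
  have [x1 [x2 [x3 [x4 [x5 [x6 [X ->]]]]]]] := decomposition x.
  rewrite P_components // (U_components X) (Q_components (components_U X));
    case: X => -[X1 X2 X3] [X4 X5 X6].
  rewrite U_components; last first.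
    by do 2![split] => //; [exact: subspace0 s3|exact: subspace0 s4].
  have Ma := MU0 X5; have Mc := MU0 (MD X6).
  rewrite DDs; last by mem5.
  by rewrite !(rotation_sqr Ma Mc) zC2 zU4 zD zU0 zS zT subr0 !addr0.
- apply/funext => x /=.
  have [x1 [x2 [x3 [x4 [x5 [x6 [X ->]]]]]]] := decomposition x.
  rewrite Q_components // (U_components X) (P_components (components_U X));
    case: X => -[X1 X2 X3] [X4 X5 X6].
  have MDx := MD X6.
  rewrite U_components; last first.
    by do 2![split] => //; [exact: subspace0 s2|exact: subspace0 s4|mem5..].
  rewrite DDs; last by mem5.
  rewrite !US ?UT; try by mem5.
  have Ma := MU0 X5; have Mc := MU0 MDx.
  have -> : U0 (S x5 + T (D x6)) = S (U0 x5) + T (U0 (D x6)).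
    by rewrite (bounded_opD b0) ?US ?UT //; mem5.
  by rewrite zC3 zU4 sqrS_add_sqrT ?S_T_commute ?subrr ?zDs //; mem5.
Qed.

End Form.

(** * Intertwining operators *)

(** P (U x) = U (Q x) and Q (U x) = U (P x): the eigenvalues of P and Q at x are
exchanged at U x. *)
Lemma intertwining_maps U : intertwining dot P Q U ->
  [/\ unitary_op dot M1 M1 U, unitary_op dot M3 M2 U,
      unitary_op dot M2 M3 U & unitary_op dot M4 M4 U].
Proof.
move=> [uU UP PU].
have QU x : Q (U x) = U (P x) by have := congr1 (@^~ x) UP => /= ->.
have PUQ x : P (U x) = U (Q x) by have := congr1 (@^~ x) PU => /= ->.
have inj x y : U x = U y -> x = y.
  by move=> h; apply: (unitary_inj uU (I : setT x) (I : setT y) h).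
have U0 : U 0 = 0 by exact: bounded_op0 (subspaceT H) (unitary_bop uU).
have eqU x y : (U x = U y) <-> x = y by split=> [/inj|->].
have eq0 x : (U x = 0) <-> x = 0 by rewrite -[in X in X <-> _]U0.
split; apply: unitary_restrict => // x;
  rewrite !(H1P, H2P, H3P, H4P) QU PUQ !(eqU, eq0); tauto.
Qed.

Lemma intertwining_same_dim U : intertwining dot P Q U -> same_dim dot M2 M3.
Proof. by case/intertwining_maps => _ _ h _; exact: unitary_same_dim h. Qed.

(** Besides existence, the explicit matrix of W is recorded: W is the reference
intertwiner against which the others are compared. *)
Lemma same_dim_intertwining : same_dim dot M2 M3 -> exists C2 C3 W,
  [/\ unitary_op dot M3 M2 C2, unitary_op dot M2 M3 C3,
      acts_as dot P Q W (intertwining_form idfun C2 C3 idfun idfun)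
    & intertwining dot P Q W].
Proof.
move=> dim.
have uid M : subspace M -> unitary_op dot M M idfun.
  by move=> sM; apply: isometry_unitary => // y My; exists y.
have [C3 u3] := same_dim_unitary dot_norm s2 H2_closed.2 s3 H3_closed.2 dim.
have [C2 u2] : exists V, unitary_op dot M3 M2 V.
  case: u3 => g [[b b' adj] gC Cg]; exists g, C3; split=> //.
  by split=> // x y Mx My; rewrite dotC -adj // -dotC.
have [W hW] := acts_as_exists
  (intertwining_form idfun C2 C3 idfun idfun).
exists C2, C3, W; split=> //.
by apply: (form_intertwining (uid _ s1) u2 u3 (uid _ s4) (uid _ s5) _ hW).
Qed.

(** H1 + H2 + H5 is the range of P, so H6 can be described without H5; this makes
it visibly invariant under unitaries commuting with P and Q. *)
Lemma H6_kernel x : M6 x <->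
  [/\ P x = 0, forall y, M3 y -> dot x y = 0 & forall y, M4 y -> dot x y = 0].
Proof.
split=> [Mx|[Px h3 h4]].
  split; [|by move=> y; exact: (orth63 Mx)
          |by move=> y; exact: (orth64 Mx)].
  have := @P_components 0 0 0 0 0 x; rewrite !(addr0, add0r); apply.
  by do 2![split] => //; exact: subspace0.
apply/(H6P); split=> // y.
- by case=> /(rangeE projP) <- _; rewrite -(proj_sym projP) Px dot0l.
- by case=> /(rangeE projP) <- _; rewrite -(proj_sym projP) Px dot0l.
- by case=> /(rangeE projP) <- _; rewrite -(proj_sym projP) Px dot0l.
Qed.

Lemma Q_on5 x : M5 x -> Q x = S (S x) + Ds (T (S x)).
Proof.
move=> Mx; have z6 := subspace0 s6.
have : components 0 0 0 0 x 0 by do 2![split] => //; exact: subspace0.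
move/Q_components; rewrite !(addr0, add0r) (bounded_op0 s6 bD) (bounded_op0 s5 bT)
  !(addr0, add0r).
by [].
Qed.

Lemma Q_on6 x : M6 x -> Q x = S (T (D x)) + Ds (T (T (D x))).
Proof.
move=> Mx.
have : components 0 0 0 0 0 x by do 2![split] => //; exact: subspace0.
by move/Q_components; rewrite !(addr0, add0r) (bounded_op0 s5 bS) !(addr0, add0r).
Qed.

Lemma sum56_inj x y x' y' : M5 x -> M6 y -> M5 x' -> M6 y' ->
  x + y = x' + y' -> x = x' /\ y = y'.
Proof.
move=> Mx My Mx' My' /eqP; rewrite -subr_eq0 -sum_of_differences => /eqP h.
have := @components_eq0 0 0 0 0 (x - x') (y - y').
rewrite !add0r; case=> //.
  by do 2![split]; try exact: subspace0; exact: subspaceB.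
by move=> _ [_ /subr0_eq -> /subr0_eq ->].
Qed.

(** * Unitary operators commuting with both projections *)

Section Commutant.
Variable V : H -> H.
Hypotheses (uV : unitary_op dot setT setT V)
  (VP : forall x, V (P x) = P (V x)) (VQ : forall x, V (Q x) = Q (V x)).

Let V_eq x y : (V x = V y) <-> x = y.
Proof.
split=> [h|->//].
exact: (unitary_inj uV (I : setT x) (I : setT y) h).
Qed.
Let V0 : V 0 = 0. Proof. exact: bounded_op0 (subspaceT H) (unitary_bop uV). Qed.
Let V_eq0 x : (V x = 0) <-> x = 0.
Proof. by rewrite -[in X in X <-> _]V0. Qed.

Let V_orth M x : (forall y, M y <-> M (V y)) ->
  (forall y, M y -> dot x y = 0) <-> (forall y, M y -> dot (V x) y = 0).
Proof.
move=> MV; split=> h y My.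
  have [z _ zy] := unitary_onto uV (I : setT y); rewrite -zy in My *.
  by rewrite (unitary_dot uV (I : setT x) (I : setT z)); apply: h; apply/MV.
rewrite -(unitary_dot uV (I : setT x) (I : setT y)); apply: h.
exact: (MV y).1.
Qed.

Lemma commutant_maps :
  unitary_op dot M5 M5 V /\ unitary_op dot M6 M6 V.
Proof.
have h1 x : M1 x <-> M1 (V x) by rewrite !H1P -VP -VQ !V_eq.
have h2 x : M2 x <-> M2 (V x) by rewrite !H2P -VP -VQ !(V_eq, V_eq0).
have h3 x : M3 x <-> M3 (V x) by rewrite !H3P -VP -VQ !(V_eq, V_eq0).
have h4 x : M4 x <-> M4 (V x) by rewrite !H4P -VP -VQ !(V_eq, V_eq0).
split; apply: unitary_restrict => // x.
  rewrite !(H5P) -VP; split.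
    by move=> [/V_eq ? /(V_orth x h1) ? /(V_orth x h2) ?].
  by move=> [/V_eq ? /(V_orth x h1) ? /(V_orth x h2) ?].
rewrite !H6_kernel -VP; split.
  by move=> [/V_eq0 ? /(V_orth x h3) ? /(V_orth x h4) ?].
by move=> [/V_eq0 ? /(V_orth x h3) ? /(V_orth x h4) ?].
Qed.

(** Both facts come from the H5-components of V Q x = Q V x.  For x in H5 they
give commutation with Q0; for x in H6 they read V S T D x = S T D V x, where S T
is injective and commutes with V. *)
Lemma commutant_blocks : (forall x, M5 x -> V (Q0 x) = Q0 (V x)) /\
  (forall x, M6 x -> D (V x) = V (D x)).
Proof.
have [u5 u6] := commutant_maps.
have b5 := unitary_bop u5; have b6 := unitary_bop u6.
have MV5 x : M5 x -> M5 (V x) by move=> h; exact: (bounded_op_in b5).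
have MV6 x : M6 x -> M6 (V x) by move=> h; exact: (bounded_op_in b6).
have VD x y : V (x + y) = V x + V y by apply: (bounded_opD (unitary_bop uV)).
have VQ0 x : M5 x -> V (Q0 x) = Q0 (V x).
  move=> Mx; have Mv := MV5 _ Mx; have := VQ x; rewrite !Q_on5 // VD -!SS //.
  move=> /sum56_inj; case=> //; try by mem5.
  - by apply: MV5; mem5.
  - by apply: MV6; mem5.
split=> // x Mx.
have [VS VT] := commute_sqrt b5 VQ0.
have Mv := MV6 _ Mx.
have := VQ x; rewrite !Q_on6 // VD => /sum56_inj; case; try by mem5.
- by apply: MV5; mem5.
- by apply: MV6; mem5.
have MDx := MD Mx; have MVDx := MV5 _ MDx; have MDVx := MD Mv.
rewrite VS ?VT //; last by mem5.
move=> h _; apply/eqP; rewrite -subr_eq0; apply/eqP.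
apply: T_eq0; first by mem5.
apply: S_eq0; first by mem5.
by rewrite (bounded_opB s5 bT) ?(bounded_opB s5 bS) ?h ?subrr //; mem5.
Qed.
End Commutant.

(** U = W V with V = W^-1 U in the commutant of P and Q, and U0 is the
restriction of V to H5. *)
Lemma intertwining_has_form U : intertwining dot P Q U -> exists U0,
  [/\ unitary_op dot M5 M5 U0, forall x, M5 x -> U0 (Q0 x) = Q0 (U0 x)
    & acts_as dot P Q U (intertwining_form U U U U U0)].
Proof.
move=> iU; have [C2 [C3 [W [u2 u3 W_form iW]]]] :=
  same_dim_intertwining (intertwining_same_dim iU).
case: (iU) => uU UP PU; case: (iW) => uW WP PW.
have eW x y : W x = W y -> x = y.
  by move=> h; apply: (unitary_inj uW (I : setT x) (I : setT y) h).
have /choice [V WV] : forall x, exists v, W v = U x.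
  by move=> x; have [v _ ?] := unitary_onto uW (I : setT (U x)); exists v.
have uV : unitary_op dot setT setT V.
  apply: isometry_unitary => // [x y _ _|y _].
    by rewrite -(unitary_dot uW) // !WV (unitary_dot uU).
  have [x _ xy] := unitary_onto uU (I : setT (W y)).
  by exists x => //; apply: eW; rewrite WV.
have VP x : V (P x) = P (V x).
  apply: eW; rewrite WV.
  have -> : W (P (V x)) = Q (W (V x)) by have := congr1 (@^~ (V x)) WP => /= ->.
  by rewrite WV; have := congr1 (@^~ x) UP => /= ->.
have VQ x : V (Q x) = Q (V x).
  apply: eW; rewrite WV.
  have -> : W (Q (V x)) = P (W (V x)) by have := congr1 (@^~ (V x)) PW => /= ->.
  by rewrite WV; have := congr1 (@^~ x) PU => /= ->.
have [u5 u6] := commutant_maps uV VP VQ.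
have [VQ0 VD] := commutant_blocks uV VP VQ.
exists V; split=> // x1 x2 x3 x4 x5 x6 X1 X2 X3 X4 X5 X6.
have X : components x1 x2 x3 x4 x5 x6 by [].
rewrite (intertwining_formE U U U U u5 X).
have UD x y : U (x + y) = U x + U y by apply: (bounded_opD (unitary_bop uU)).
have Vx5 := bounded_op_in (unitary_bop u5) X5;
  have Vx6 := bounded_op_in (unitary_bop u6) X6.
have V56 : U (x5 + x6) = S (V x5) + T (V (D x6)) + Ds (T (V x5) - S (V (D x6))).
  have uid : unitary_op dot M5 M5 idfun.
    by apply: isometry_unitary => // y My; exists y.
  have z1 := subspace0 s1; have z2 := subspace0 s2; have z3 := subspace0 s3;
    have z4 := subspace0 s4.
  have Y : components 0 0 0 0 (V x5) (V x6) by [].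
  rewrite -WV (bounded_opD (unitary_bop uV)) //.
  have := W_form _ _ _ _ _ _ z1 z2 z3 z4 Vx5 Vx6.
  rewrite (intertwining_formE idfun C2 C3 idfun uid Y) /= VD //.
  by rewrite (bounded_op0 s3 (unitary_bop u2)) (bounded_op0 s2 (unitary_bop u3))
    !(add0r, addr0).
by rewrite -(addrA _ x5) UD V56 !UD !addrA (addrAC (U x1)).
Qed.
End TwoProjections.

(* S = Q0^{1/2}, T = (I_5 - Q0)^{1/2} and Ds = D^*. *)
Theorem theorem3p1 (R : realType) (H : completeNormedModType R[i])
    (dot : {dot H for @Num.conj R[i]})
    (dot_norm : forall x : H, dot x x = `|x| ^+ 2)
    (P Q : H -> H)
    (projP : orthogonal_projection dot P)
    (projQ : orthogonal_projection dot Q)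
    (Q0 S T D Ds : H -> H)
    (Q0_pos : positive_op dot (H5 dot P Q) Q0)
    (Q0_contr : contraction (H5 dot P Q) Q0)
    (Q0_eig0 : ~ is_eigenvalue (H5 dot P Q) Q0 0)
    (Q0_eig1 : ~ is_eigenvalue (H5 dot P Q) Q0 1)
    (S_sqrt : is_psqrt dot (H5 dot P Q) Q0 S)
    (T_sqrt : is_psqrt dot (H5 dot P Q) (idfun \- Q0) T)
    (D_unitary : unitary_op dot (H6 dot P Q) (H5 dot P Q) D)
    (Ds_adj : adjoint_op dot (H6 dot P Q) (H5 dot P Q) D Ds)
    (P_matrix : acts_as dot P Q P (fun x1 x2 x3 x4 x5 x6 =>
       x1 + x2 + 0 + 0 + x5 + 0))
    (Q_matrix : acts_as dot P Q Q (fun x1 x2 x3 x4 x5 x6 =>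
       x1 + 0 + x3 + 0
       + join2 (block2 Q0             (S \o T \o D)
                       (Ds \o S \o T) (Ds \o (idfun \- Q0) \o D) (x5, x6)))) :
  ((exists U : H -> H,
      [/\ unitary_op dot setT setT U, P \o U = U \o Q & U \o P = Q \o U])
   <-> same_dim dot (range P `&` nullspace Q) (nullspace P `&` range Q))
  /\
  (same_dim dot (range P `&` nullspace Q) (nullspace P `&` range Q) ->
   intertwining dot P Q =
   [set U : H -> H | bounded_op setT setT U /\
      exists U1 C2 C3 U4 U0 : H -> H,
        [/\ unitary_op dot (H1 P Q) (H1 P Q) U1,
            unitary_op dot (H3 P Q) (H2 P Q) C2,
            unitary_op dot (H2 P Q) (H3 P Q) C3 &
            unitary_op dot (H4 P Q) (H4 P Q) U4] /\
        [/\ unitary_op dot (H5 dot P Q) (H5 dot P Q) U0,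
            (forall x, H5 dot P Q x -> U0 (Q0 x) = Q0 (U0 x)) &
            acts_as dot P Q U (fun x1 x2 x3 x4 x5 x6 =>
              U1 x1
              + join2 (block2 \0 C2
                              C3 \0 (x2, x3))
              + U4 x4
              + join2 (block2 S         (T \o D)
                              (Ds \o T) (\- (Ds \o S \o D))
                        (block2 U0 \0
                                \0 (Ds \o U0 \o D) (x5, x6))))]]).
Proof.
have has_form := intertwining_has_form dot_norm projP projQ Q0_pos Q0_eig0
  Q0_eig1 S_sqrt T_sqrt D_unitary Ds_adj P_matrix Q_matrix.
have from_dim := same_dim_intertwining dot_norm projP projQ Q0_pos Q0_eig0
  Q0_eig1 S_sqrt T_sqrt D_unitary Ds_adj P_matrix Q_matrix.
have from_form := form_intertwining dot_norm projP projQ Q0_pos Q0_eig0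
  Q0_eig1 S_sqrt T_sqrt D_unitary Ds_adj P_matrix Q_matrix.
split.
  split=> [[U [uU PU UP]]|/from_dim [C2 [C3 [W [_ _ _ [uW WP PW]]]]]].
    exact: (intertwining_same_dim dot_norm projP projQ (U := U)).
  by exists W.
move=> _; apply/seteqP; split=> U.
  move=> iU; have [U0 [u0 U0Q0 U_form]] := has_form _ iU.
  have [u1 u2 u3 u4] := intertwining_maps dot_norm projP projQ iU.
  by case: iU => uU _ _; split; [exact: unitary_bop uU|exists U, U, U, U, U0].
move=> [_ [U1 [C2 [C3 [U4 [U0 [[u1 u2 u3 u4] [u0 U0Q0 U_form]]]]]]]].
exact: (from_form _ _ _ _ _ u1 u2 u3 u4 u0 U0Q0 _ U_form).
Qed.
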